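(* Let $A$ be an algebra, $T$ a separating tilting $A$-module, $B=\mathrm{End}_A(T)$ and $F'=\mathrm{Ext}^1_A(T,-)$. Let $M,N$ be indecomposable $A$-modules in $\mathcal{F}(T)$. If $g\in\Re_A^n(M,N)$ for some $n\geq1$, then $F'(g)\in\Re_B^n(F'(M),F'(N))$. In addition, if $\mathrm{dp}(F'(g))=n$, then there is a non-zero path of irreducible morphisms between indecomposable $B$-modules in $\mathcal{X}(T)$ from $F'(M)$ to $F'(N)$ of length $n$.
   Context: $k$ is an algebraically closed field; an algebra is a finite dimensional basic $k$-algebra; $\mathrm{mod}\,A$ is the category of finitely generated left $A$-modules. Radical: $\Re_A(X,Y)$ is the set of morphisms $f:X\to Y$ in $\mathrm{mod}\,A$ such that $h'fh$ is not an isomorphism for all indecomposable $M$ and all $h:M\to X$, $h':Y\to M$; powers $\Re_A^n$ are defined inductively, and $\Re_A^\infty=\bigcap_{i\ge1}\Re_A^i$. The depth $\mathrm{dp}(f)$ is $n$ if $f\in\Re^n\setminus\Re^{n+1}$, and $\infty$ if $f\in\Re^\infty$. A morphism $f$ is irreducible if it does not split and $f=gh$ implies $h$ is a split monomorphism or $g$ is a split epimorphism. A non-zero path of irreducible morphisms of length $t$ is a sequence $M_0\to M_1\to\cdots\to M_t$ of $t$ irreducible morphisms between indecomposable modules with non-zero composition. Tilting: $T$ is a tilting $A$-module if $\mathrm{pd}\,T\le1$, $\mathrm{Ext}^1_A(T,T)=0$ and the number of isomorphism classes of indecomposable summands of $T$ equals the number of isomorphism classes of simple $A$-modules. With $B=\mathrm{End}_A(T)$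 (conventions chosen so that $\mathrm{Hom}_A(T,-)$ and $\mathrm{Ext}^1_A(T,-)$ take values in $\mathrm{mod}\,B$), put $\mathcal{T}(T)=\{X:\mathrm{Ext}^1_A(T,X)=0\}$, $\mathcal{F}(T)=\{X:\mathrm{Hom}_A(T,X)=0\}$ in $\mathrm{mod}\,A$, and $\mathcal{X}(T)=\{Y:Y\otimes_BT=0\}$, $\mathcal{Y}(T)=\{Y:\mathrm{Tor}_1^B(Y,T)=0\}$ in $\mathrm{mod}\,B$. By the Brenner–Butler theorem $\mathrm{Hom}_A(T,-)$ restricts to an equivalence $\mathcal{T}(T)\to\mathcal{Y}(T)$ and $\mathrm{Ext}^1_A(T,-)$ to an equivalence $\mathcal{F}(T)\to\mathcal{X}(T)$. $T$ is separating if every indecomposable $A$-module lies in $\mathcal{T}(T)$ or in $\mathcal{F}(T)$. *)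

(* Defs.v *)
From HB Require Import structures.
From mathcomp Require Import all_boot all_algebra all_field.
From mathcomp Require Import boolp classical_sets functions.

Set Implicit Arguments.
Unset Strict Implicit.
Unset Printing Implicit Defensive.

Import GRing.Theory.
Local Open Scope ring_scope.
Local Open Scope quotient_scope.

Section Modules.
Variable R : pzRingType.
Implicit Types X Y Z M : lmodType R.

Definition fin_gen M :=
  exists (n : nat) (v : 'I_n -> M),
    forall m, exists c : 'I_n -> R, m = \sum_(i < n) c i *: v i.

Definition is_zero M := forall m : M, m = 0.

Definition isomorphic X Y := exists f : {linear X -> Y}, bijective f.

Definition indecomposable M :=
  [/\ fin_gen M, ~ is_zero M &
      forall X Y, isomorphic M (X * Y)%type -> is_zero X \/ is_zero Y].

Definition summand X M := exists Y, isomorphic M (X * Y)%type.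

Definition simple_module M :=
  ~ is_zero M /\
  forall S : {pred M}, submod_closed S ->
    (forall x, x \in S -> x = 0) \/ (forall x, x \in S).

(* There are exactly n isomorphism classes of modules satisfying C. *)
Definition num_iso_classes (C : lmodType R -> Prop) (n : nat) :=
  exists S : 'I_n -> lmodType R,
    [/\ forall i, C (S i),
        forall i j, isomorphic (S i) (S j) -> i = j &
        forall M, C M -> exists i, isomorphic M (S i)].

Definition surjective X Y (f : X -> Y) := forall y, exists x, f x = y.

Definition projective (P : lmodType R) :=
  forall X Y (p : {linear X -> Y}) (f : {linear P -> Y}), surjective p ->
    exists g : {linear P -> X}, p \o g =1 f.

Definition short_exact X Y Z (i : {linear X -> Y}) (p : {linear Y -> Z}) :=
  [/\ injective i, surjective p &
      forall y, p y = 0 <-> exists x, i x = y].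

Definition pd_le1 M :=
  exists (P1 P0 : lmodType R) (i : {linear P1 -> P0}) (p : {linear P0 -> M}),
    [/\ fin_gen P1 /\ projective P1, fin_gen P0 /\ projective P0 &
        short_exact i p].

(* R is, as a left module over itself, an (internal) direct sum of pairwise   *)
(* non-isomorphic indecomposable modules.                                     *)
Definition basic :=
  exists (n : nat) (P : 'I_n -> lmodType R)
         (u : forall i, {linear P i -> R^o}),
    [/\ forall i, indecomposable (P i),
        forall i j, isomorphic (P i) (P j) -> i = j &
        forall a : R^o, exists! x : (forall i, P i), a = \sum_(i < n) u i (x i)].

Definition split_mono X Y (f : {linear X -> Y}) :=
  exists g : {linear Y -> X}, g \o f =1 id.

Definition split_epi X Y (f : {linear X -> Y}) :=
  exists g : {linear Y -> X}, f \o g =1 id.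

Definition irreducible_morphism X Y (f : {linear X -> Y}) :=
  [/\ ~ split_mono f, ~ split_epi f &
      forall Z (h : {linear X -> Z}) (g : {linear Z -> Y}),
        fin_gen Z -> f =1 g \o h -> split_mono h \/ split_epi g].

Definition radical X Y (f : {linear X -> Y}) :=
  forall M (h : {linear M -> X}) (h' : {linear Y -> M}),
    indecomposable M -> ~ bijective (h' \o f \o h).

Definition morphism_class := forall X Y, {linear X -> Y} -> Prop.

(* Product of ideals of the category of finitely generated modules: finite    *)
(* sums of composites.                                                        *)
Definition ideal_prod (I J : morphism_class) : morphism_class :=
  fun X Y f =>
    exists (m : nat) (Z : 'I_m -> lmodType R)
           (g : forall i, {linear X -> Z i}) (h : forall i, {linear Z i -> Y}),
      (forall i, [/\ fin_gen (Z i), I _ _ (g i) & J _ _ (h i)]) /\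
      forall x, f x = \sum_(i < m) h i (g i x).

Fixpoint rad_pow (n : nat) : morphism_class :=
  match n with
  | 0 => fun _ _ _ => True
  | 1 => radical
  | n'.+1 => ideal_prod radical (rad_pow n')
  end.

Definition has_depth (n : nat) X Y (f : {linear X -> Y}) :=
  rad_pow n f /\ ~ rad_pow n.+1 f.

(* irr_path C n f: f is the composite of a sequence of n irreducible          *)
(* morphisms between indecomposable modules all belonging to C.               *)
Inductive irr_path (C : lmodType R -> Prop) :
    nat -> forall X Y, {linear X -> Y} -> Prop :=
| irr_path_nil X : indecomposable X -> C X ->
    irr_path C 0 (idfun : {linear X -> X})
| irr_path_cons n X Y Z (f : {linear X -> Y}) (g : {linear Y -> Z}) :
    indecomposable X -> C X -> irreducible_morphism f ->
    irr_path C n g -> irr_path C n.+1 (g \o f : {linear X -> Z}).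

End Modules.

Arguments rad_pow {R} n [X Y] f.
Arguments has_depth {R} n [X Y] f.

Lemma linear_ext (R : pzRingType) (U V : lmodType R) (f g : {linear U -> V}) :
  f =1 g -> f = g.
Proof.
case: f g => f [[fN] [fZ]] [g [[gN] [gZ]]] /= /funext fg.
by case: _ / fg in gN gZ *; rewrite (Prop_irrelevance fN gN) (Prop_irrelevance fZ gZ).
Qed.

Section Endomorphisms.
Variables (R : pzRingType) (T : lmodType R).

Definition endo := {linear T -> T}.

HB.instance Definition _ := gen_eqMixin endo.
HB.instance Definition _ := gen_choiceMixin endo.

Definition endo0 : endo := (\0 : {linear T -> T}).
Definition endoN (f : endo) : endo := (\- (f : {linear T -> T}) : {linear T -> T}).
Definition endoD (f g : endo) : endo :=
  ((f : {linear T -> T}) \+ (g : {linear T -> T}) : {linear T -> T}).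
Definition endo1 : endo := (idfun : {linear T -> T}).
Definition endoM (f g : endo) : endo :=
  ((f : {linear T -> T}) \o (g : {linear T -> T}) : {linear T -> T}).

Fact endoDA : associative endoD.
Proof. by move=> f g h; apply: linear_ext => x /=; rewrite addrA. Qed.
Fact endoDC : commutative endoD.
Proof. by move=> f g; apply: linear_ext => x /=; rewrite addrC. Qed.
Fact endo0D : left_id endo0 endoD.
Proof. by move=> f; apply: linear_ext => x /=; rewrite add0r. Qed.
Fact endoND : left_inverse endo0 endoN endoD.
Proof. by move=> f; apply: linear_ext => x /=; rewrite addNr. Qed.

HB.instance Definition _ := GRing.isZmodule.Build endo endoDA endoDC endo0D endoND.

Fact endoMA : associative endoM.
Proof. by move=> f g h; apply: linear_ext. Qed.
Fact endo1M : left_id endo1 endoM.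
Proof. by move=> f; apply: linear_ext. Qed.
Fact endoM1 : right_id endo1 endoM.
Proof. by move=> f; apply: linear_ext. Qed.
Fact endoMDl : left_distributive endoM +%R.
Proof. by move=> f g h; apply: linear_ext. Qed.
Fact endoMDr : right_distributive endoM +%R.
Proof. by move=> f g h; apply: linear_ext => x /=; rewrite raddfD. Qed.

HB.instance Definition _ :=
  GRing.Zmodule_isPzRing.Build endo endoMA endo1M endoM1 endoMDl endoMDr.

End Endomorphisms.

(* The ring B: composition is reversed, so that the right action by           *)
(* precomposition on Hom(T, -) and Ext^1(T, -) makes them left B-modules.     *)
Notation End_op T := ((endo T)^c) (only parsing).

Section QuotientModule.
Variables (R : pzRingType) (V : lmodType R) (S : submodClosed V).

Definition submod_zmod : zmodClosed V := HB.pack (GRing.SubmodClosed.sort S)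
  (GRing.isZmodClosed.Build V (GRing.SubmodClosed.sort S) (GRing.submod_closedB (submodClosedP S))).

Definition quot_module := Quotient.quot submod_zmod.

HB.instance Definition _ := GRing.Zmodule.on quot_module.
HB.instance Definition _ := EqQuotient.on quot_module.

Definition quot_proj (v : V) : quot_module := \pi_(quot_module) v.

Lemma quot_projP u v : quot_proj u = quot_proj v <-> u - v \in S.
Proof. by split=> [/eqP|?]; last apply/eqP; rewrite -Quotient.idealrBE. Qed.

Lemma quot_projK (q : quot_module) : quot_proj (repr q) = q.
Proof. exact: reprK. Qed.

Lemma quot_projD u v : quot_proj (u + v) = quot_proj u + quot_proj v.
Proof. exact: Quotient.pi_add. Qed.

Definition quot_scale (a : R) (q : quot_module) := quot_proj (a *: repr q).

Lemma quot_scaleE a v : quot_scale a (quot_proj v) = quot_proj (a *: v).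
Proof.
by apply/quot_projP; rewrite -scalerBr rpredZ //; apply/quot_projP/quot_projK.
Qed.

Fact quot_scaleA a b q : quot_scale a (quot_scale b q) = quot_scale (a * b) q.
Proof. by rewrite -(quot_projK q) !quot_scaleE scalerA. Qed.
Fact quot_scale1 : left_id 1 quot_scale.
Proof. by move=> q; rewrite -(quot_projK q) quot_scaleE scale1r. Qed.
Fact quot_scaleDr : right_distributive quot_scale +%R.
Proof.
move=> a p q; rewrite -(quot_projK p) -(quot_projK q).
by rewrite -quot_projD !quot_scaleE scalerDr quot_projD.
Qed.
Fact quot_scaleDl q : {morph quot_scale^~ q : a b / a + b}.
Proof.
by move=> a b; rewrite -(quot_projK q) !quot_scaleE scalerDl quot_projD.
Qed.

HB.instance Definition _ := GRing.Zmodule_isLmodule.Build R quot_module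
  quot_scaleA quot_scale1 quot_scaleDr quot_scaleDl.

Lemma quot_projZ a v : quot_proj (a *: v) = a *: quot_proj v.
Proof. by rewrite -quot_scaleE. Qed.

End QuotientModule.

(* Ext^1_A(T, X) is computed by the bar resolution                            *)
(*   ... -> A (x) A (x) A (x) T -> A (x) A (x) T -> A (x) T -> T -> 0         *)
(* (tensor products over k), which is functorial in T. Since Hom_A(A (x) V, X)*)
(* = Hom_k(V, X), applying Hom_A(-, X) yields the complex                     *)
(*   Hom_k(T, X) -> Hom_k(A (x) T, X) -> Hom_k(A (x) A (x) T, X)              *)
(* with differentials bar_d0 and bar_d1, and Ext^1_A(T, X) is its cohomology  *)
(* in the middle. A scalar c of k acts on an A-module through c%:A.           *)
Section Ext1.
Variables (k : fieldType) (A : falgType k).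
Implicit Types T X Y : lmodType A.

Definition klinear T X (h : T -> X) :=
  forall (c : k) x y, h (c%:A *: x + y) = c%:A *: h x + h y.

Definition kbilinear T X (d : A -> T -> X) :=
  (forall a, klinear (d a)) /\
  (forall (c : k) a b t, d (c *: a + b) t = c%:A *: d a t + d b t).

Definition bar_d0 T X (h : T -> X) : A -> T -> X :=
  fun a t => a *: h t - h (a *: t).

Definition bar_d1 T X (d : A -> T -> X) : A -> A -> T -> X :=
  fun a b t => a *: d b t - d (a * b) t + d a (b *: t).

Definition cocycle T X : {pred A -> T -> X} :=
  fun d => `[< kbilinear d /\ bar_d1 d = 0 >].
Arguments cocycle T X d : clear implicits.

Lemma cocycleP T X (d : A -> T -> X) :
  reflect (kbilinear d /\ bar_d1 d = 0) (d \in cocycle T X).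
Proof. exact: asboolP. Qed.

Fact bar_d1B T X (d e : A -> T -> X) : bar_d1 (d - e) = bar_d1 d - bar_d1 e.
Proof.
apply/funext=> a; apply/funext=> b; apply/funext=> t.
change (a *: (d b t - e b t) - (d (a * b) t - e (a * b) t)
          + (d a (b *: t) - e a (b *: t)) = bar_d1 d a b t - bar_d1 e a b t).
by rewrite scalerBr !opprD [X in X + _ = _]addrACA [LHS]addrACA.
Qed.

Fact cocycle_zmod_closed T X : zmod_closed (cocycle T X).
Proof.
split=> [|d e /cocycleP[[dl dr] d0] /cocycleP[[el er] e0]]; apply/cocycleP.
  split; first by split=> [a c x y|c a b t]; rewrite scaler0 addr0.
  apply/funext=> a; apply/funext=> b; apply/funext=> t.
  by rewrite /bar_d1 scaler0 subrr addr0.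
split; last by rewrite bar_d1B d0 e0 subrr.
have deE a t : (d - e) a t = d a t - e a t by [].
by split=> [a c x y|c a b t]; rewrite !deE ?dl ?el ?dr ?er scalerBr opprD addrACA.
Qed.

HB.instance Definition _ T X :=
  GRing.isZmodClosed.Build (A -> T -> X) (cocycle T X)
    (cocycle_zmod_closed T X).

Definition Z1 T X := {d : A -> T -> X | d \in cocycle T X}.

HB.instance Definition _ T X := SubChoice.on (Z1 T X).
HB.instance Definition _ T X := [SubChoice_isSubZmodule of Z1 T X by <:].

Fact klinearD T X (h : T -> X) : klinear h -> {morph h : x y / x + y}.
Proof. by move=> hl x y; have := hl 1 x y; rewrite !scale1r. Qed.

Fact linear_klinear T X (f : {linear T -> X}) : klinear f.
Proof. by move=> c x y; rewrite linearP. Qed.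

Fact klinear_comp T X Y (h : X -> Y) (g : T -> X) :
  klinear h -> klinear g -> klinear (h \o g).
Proof. by move=> hl gl c x y; rewrite /= gl hl. Qed.

Section Action.
Variables T X : lmodType A.

Fact Z1_act_subproof (b : End_op T) (d : Z1 T X) :
  (fun a t => val d a ((b : {linear T -> T}) t)) \in cocycle T X.
Proof.
have /cocycleP[[dl dr] d0] := valP d; apply/cocycleP; split.
  by split=> [a c x y|c a a' t]; [rewrite linearP dl | rewrite dr].
apply/funext=> a; apply/funext=> a'; apply/funext=> t.
have := congr1 (fun F => F a a' ((b : {linear T -> T}) t)) d0.
by rewrite /bar_d1 linearZ.
Qed.

Definition Z1_act (b : End_op T) (d : Z1 T X) : Z1 T X :=
  exist (fun d => d \in cocycle T X) _ (Z1_act_subproof b d).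

Fact Z1_actA b b' d : Z1_act b (Z1_act b' d) = Z1_act (b * b') d.
Proof. exact/val_inj. Qed.
Fact Z1_act1 : left_id 1 Z1_act.
Proof. by move=> d; apply/val_inj. Qed.
Fact Z1_actDr : right_distributive Z1_act +%R.
Proof. by move=> b d e; apply/val_inj. Qed.
Fact Z1_actDl d : {morph Z1_act^~ d : b b' / b + b'}.
Proof.
move=> b b'; apply/val_inj/funext=> a; apply/funext=> t /=.
have /cocycleP[[dl _] _] := valP d.
exact: (klinearD (dl a) ((b : {linear T -> T}) t) ((b' : {linear T -> T}) t)).
Qed.

HB.instance Definition _ := GRing.Zmodule_isLmodule.Build (End_op T) (Z1 T X)
  Z1_actA Z1_act1 Z1_actDr Z1_actDl.

Definition coboundary : {pred Z1 T X} :=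
  fun d => `[< exists h : T -> X, klinear h /\ val d = bar_d0 h >].

Lemma coboundaryP (d : Z1 T X) :
  reflect (exists h : T -> X, klinear h /\ val d = bar_d0 h) (d \in coboundary).
Proof. exact: asboolP. Qed.

Fact coboundary_submod_closed : submod_closed coboundary.
Proof.
split=> [|b d e /coboundaryP[h [hl dE]] /coboundaryP[g [gl eE]]].
  apply/coboundaryP; exists (fun=> 0); split.
    by move=> c x y; rewrite scaler0 addr0.
  by apply/funext=> a; apply/funext=> t; rewrite /bar_d0 scaler0 subrr.
apply/coboundaryP; exists (fun t => h ((b : {linear T -> T}) t) + g t); split.
  by move=> c x y; rewrite linearP hl gl scalerDr addrACA.
apply/funext=> a; apply/funext=> t.
have -> : val (b *: d + e) a t = val d a ((b : {linear T -> T}) t) + val e a t.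
  by [].
by rewrite dE eE /bar_d0 linearZ scalerDr opprD addrACA.
Qed.

HB.instance Definition _ :=
  GRing.isSubmodClosed.Build (End_op T) (Z1 T X) coboundary
    coboundary_submod_closed.

Definition Ext1 : lmodType (End_op T) := quot_module coboundary.

End Action.
Arguments coboundary T X d : clear implicits.

Section Functoriality.
Variables (T X Y : lmodType A) (f : {linear X -> Y}).

Fact Z1_map_subproof (d : Z1 T X) :
  (fun a t => f (val d a t)) \in cocycle T Y.
Proof.
have /cocycleP[[dl dr] d0] := valP d; apply/cocycleP; split.
  by split=> [a c x y|c a a' t]; rewrite ?dl ?dr linearP.
apply/funext=> a; apply/funext=> a'; apply/funext=> t.
have := congr1 (fun F => f (F a a' t)) d0.
by rewrite /bar_d1 linearD linearB linearZ linear0.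
Qed.

Definition Z1_map (d : Z1 T X) : Z1 T Y :=
  exist (fun d => d \in cocycle T Y) _ (Z1_map_subproof d).

Definition Ext1_map (q : Ext1 T X) : Ext1 T Y :=
  quot_proj (coboundary T Y) (Z1_map (repr q)).

Lemma Ext1_mapE (d : Z1 T X) :
  Ext1_map (quot_proj (coboundary T X) d) =
    quot_proj (coboundary T Y) (Z1_map d).
Proof.
apply/quot_projP.
have /quot_projP/coboundaryP[h [hl hE]] :=
  quot_projK (quot_proj (coboundary T X) d).
apply/coboundaryP; exists (f \o h); split.
  exact/klinear_comp/hl/linear_klinear.
apply/funext=> a; apply/funext=> t; have := congr1 (fun F => f (F a t)) hE.
by rewrite /bar_d0 /= !linearB linearZ.
Qed.

Fact Ext1_map_linear : linear Ext1_map.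
Proof.
move=> b p q; rewrite -(quot_projK p) -(quot_projK q).
move: (repr p) (repr q) => d e.
rewrite -[b *: quot_proj _ d]quot_projZ -[X in Ext1_map X]quot_projD !Ext1_mapE.
rewrite -[b *: quot_proj _ _]quot_projZ -[RHS]quot_projD.
congr quot_proj; apply/val_inj/funext=> a; apply/funext=> t.
exact: linearD.
Qed.

HB.instance Definition _ := GRing.isLinear.Build (End_op T) (Ext1 T X) (Ext1 T Y)
  *:%R Ext1_map Ext1_map_linear.

End Functoriality.

Definition in_T T X := is_zero (Ext1 T X).

Definition in_F T X := forall (h : {linear T -> X}) t, h t = 0.

Definition tilting T :=
  [/\ fin_gen T, pd_le1 T, is_zero (Ext1 T T) &
      exists n, num_iso_classes (fun X => indecomposable X /\ summand X T) n /\
                num_iso_classes (@simple_module A) n].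

Definition separating T :=
  forall X : lmodType A, indecomposable X -> in_T T X \/ in_F T X.

End Ext1.

Arguments cocycle {k A} T X d.
Arguments coboundary {k A} T X d.
Arguments Ext1_map {k A} T [X Y] f q.

(* Left B-modules are right modules over the endomorphism ring, which acts on *)
(* T from the left; thus Y (x)_B T is the universal recipient of maps         *)
(* beta : Y x T -> Z that are biadditive and satisfy                          *)
(* beta (y b, t) = beta (y, b t).                                             *)
Section Tensor.
Variables (R : pzRingType) (T : lmodType R) (Y : lmodType (End_op T)).

Definition balanced (Z : zmodType) (beta : Y -> T -> Z) :=
  [/\ forall y y' t, beta (y + y') t = beta y t + beta y' t,
      forall y t t', beta y (t + t') = beta y t + beta y t' &
      forall (b : End_op T) y t,
        beta (b *: y) t = beta y ((b : {linear T -> T}) t)].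

Definition is_tensor (P : zmodType) (tau : Y -> T -> P) :=
  balanced tau /\
  forall (Z : zmodType) (beta : Y -> T -> Z), balanced beta ->
    exists h : {additive P -> Z},
      (forall y t, h (tau y t) = beta y t) /\
      forall h' : {additive P -> Z},
        (forall y t, h' (tau y t) = beta y t) -> h' =1 h.

Definition in_X :=
  exists (P : zmodType) (tau : Y -> T -> P),
    is_tensor tau /\ forall p : P, p = 0.

End Tensor.

(* Main.v *)
From HB Require Import structures.
Require Import Defs.
From mathcomp Require Import all_boot all_algebra all_field.
From mathcomp Require Import boolp functions.
Import GRing.Theory.
Local Open Scope ring_scope.

Set Implicit Arguments.
Unset Strict Implicit.
Unset Printing Implicit Defensive.

(** Write F' for Ext^1(T, -) and B for End(T). Everything rests on three facts
    about F', parts of the Brenner-Butler theorem: on the modules Z with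
    Hom(T, Z) = 0 it is faithful (Ext1_faithful) and full (Ext1_full), and its
    values lie in X(T) (Ext1_in_X).

    Given these, F' sends radical maps between indecomposable modules of F(T) to
    radical maps (radical_Ext1), and indecomposable modules to indecomposable ones
    (indecomposable_Ext1): an idempotent over B comes from an idempotent over A.
    A map g in the n-th power of the radical is a sum of composites of n radical
    maps between indecomposable modules. As T is separating, each of the
    intermediate modules is in T(T), where F' vanishes, or in F(T). So F'(g) is
    the sum of the images of the composites that stay inside F(T)
    (rad_pow_path_sum), and each of these images is a composite of n radical maps
    between modules of X(T). This gives the first assertion. If F'(g) is not in
    the next power of the radical, one of the summands is not in it either; then
    none of its factors is in the square of the radical, so all are irreducible
    (irr_path_rad_path). This summand is the path required: its intermediate
    modules lie in X(T) because it is an image under F', and it is nonzero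
    because 0 lies in every power of the radical.

    The three facts are derived from the universal extension
    0 -> Z -> E -> T^n -> 0, whose components generate Ext^1(T, Z) over B, so that
    Ext^1(T, E) = 0. What makes E usable is that it is generated by T. This
    follows from tilting_orthogonal: a module K with Hom(T, K) = 0 and
    Ext^1(T, K) = 0 is zero. That is the point where the number of summands of T
    matters. The proof constructs for every indecomposable summand T_j of T a
    module L_j whose Euler form dim Hom - dim Ext^1 with the summands T_i is
    nonzero exactly for i = j (exists_test_module). Since there are as many
    summands as simple modules, expanding the L_j in composition factors shows
    that the square matrix of the Euler form of summands against simple modules is
    invertible; hence a module on which the Euler form with all summands vanishes
    has no composition factors.

    Ext^1 is computed from the bar complex, where Ext^1(U, L) and Hom(U, L) are the
    cokernel and the kernel of Hom_k(U, L) -> Z^1(U, L). The long exact sequence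
    then amounts to lifting k-linear maps, and projective dimension at most 1 means
    that cocycles lift along surjections (pd_le1_right_exact). *)

(** * Linear maps, submodules and indecomposable modules *)

Lemma exists_choice (T T' : Type) (P : T -> T' -> Prop) :
  (forall x, exists y, P x y) -> exists f : T -> T', forall x, P x (f x).
Proof. by move=> /choice[f fP]; exists f. Qed.

Section LinearMaps.
Variable R : pzRingType.
Implicit Types U V W X Y Z : lmodType R.

Definition mk_linear U V (f : U -> V) (f_lin : linear f) : {linear U -> V} :=
  HB.pack f (GRing.isLinear.Build R U V *:%R f f_lin).

Lemma linear_bij_inv U V (f : {linear U -> V}) :
  bijective f -> exists2 g : {linear V -> U}, cancel f g & cancel g f.
Proof.
case=> g fK gK.
have glin : linear g by move=> a x y; apply: (can_inj fK); rewrite linearP !gK.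
by exists (mk_linear glin).
Qed.

Lemma inj_surj_bij U V (f : {linear U -> V}) :
  injective f -> surjective f -> bijective f.
Proof.
move=> fi fs; have [g gP] := choice fs.
by exists g => // x; apply: fi; rewrite gP.
Qed.

Lemma bij_surj U V (f : U -> V) : bijective f -> surjective f.
Proof. by case=> g _ gK y; exists (g y). Qed.

Lemma linear_inj0 U V (f : {linear U -> V}) :
  (forall x, f x = 0 -> x = 0) -> injective f.
Proof.
by move=> f0 x y fxy; apply/eqP; rewrite -subr_eq0 (f0 (x - y)) // linearB fxy subrr.
Qed.

Lemma lift_through_inj U V W (i : {linear V -> W}) (f : {linear U -> W}) :
  injective i -> (forall u, exists v, i v = f u) ->
  exists g : {linear U -> V}, forall u, i (g u) = f u.
Proof.
move=> ii /choice[g gP].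
have glin : linear g by move=> a x y; apply: ii; rewrite linearP !gP linearP.
by exists (mk_linear glin).
Qed.

Lemma sum_linear U V (I : Type) (r : seq I) (f : I -> {linear U -> V}) :
  linear (fun x => \sum_(i <- r) f i x).
Proof.
move=> a x y; rewrite scaler_sumr -big_split; apply: eq_bigr => i _.
exact: linearP.
Qed.

Definition subspace V (P : V -> Prop) :=
  P 0 /\ forall a x y, P x -> P y -> P (a *: x + y).

Section Sub.
Variables (V : lmodType R) (S : submodClosed V).

Definition sub_module := {x : V | x \in (S : {pred V})}.
HB.instance Definition _ := SubChoice.on sub_module.
HB.instance Definition _ := [SubChoice_isSubLmodule of sub_module by <:].

End Sub.

Lemma subspace_submod_closed V (P : V -> Prop) :
  subspace P -> submod_closed (fun x => `[< P x >]).
Proof.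
case=> P0 PD; split; first exact/asboolP.
by move=> a x y /asboolP Px /asboolP Py; apply/asboolP/PD.
Qed.

Definition subspace_pred V (P : V -> Prop) (HP : subspace P) : submodClosed V :=
  HB.pack (fun x => `[< P x >])
   (GRing.isSubmodClosed.Build R V (fun x => `[< P x >]) (subspace_submod_closed HP)).

(** Kernels, images, cokernels and pullbacks are only ever used through such
    characterizations: a module with an injective or surjective map whose image or
    kernel is prescribed. *)
Lemma exists_submodule V (P : V -> Prop) : subspace P ->
  exists W (i : {linear W -> V}),
    injective i /\ forall x, P x <-> exists w, i w = x.
Proof.
move=> HP.
pose W : lmodType R := sub_module (subspace_pred HP).
have vlin : linear (val : W -> V) by exact: linearP.
exists W, (mk_linear vlin); split; first exact: val_inj.
move=> x; split=> [Px|[[w wP] <-]]; last exact/asboolP.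
have xP : x \in (subspace_pred HP : {pred V}) by apply/asboolP.
by exists (exist _ x xP).
Qed.

Lemma exists_quotient V (P : V -> Prop) : subspace P ->
  exists W (p : {linear V -> W}),
    surjective p /\ forall x, p x = 0 <-> P x.
Proof.
move=> HP; pose S := subspace_pred HP.
have plin : linear (@quot_proj R V S).
  by move=> a x y; rewrite quot_projD quot_projZ.
exists (quot_module S), (mk_linear plin); split.
  by move=> q; exists (repr q); apply: quot_projK.
move=> x /=.
have -> : 0 = quot_proj S 0.
  by have := quot_projD S 0 0; rewrite addr0 => /esym/(canRL (addrK _)); rewrite subrr => ->.
by rewrite quot_projP subr0; split=> /asboolP.
Qed.

Lemma subspace_image U V (f : {linear U -> V}) :
  subspace (fun y => exists x, f x = y).
Proof.
split; first by exists 0; rewrite linear0.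
by move=> a _ _ [x <-] [y <-]; exists (a *: x + y); rewrite linearP.
Qed.

Lemma subspace_kernel U V (f : {linear U -> V}) : subspace (fun x => f x = 0).
Proof.
split; first by rewrite linear0.
by move=> a x y fx fy; rewrite linearP fx fy scaler0 addr0.
Qed.

Lemma exists_kernel U V (f : {linear U -> V}) :
  exists W (i : {linear W -> U}),
    injective i /\ forall x, f x = 0 <-> exists w, i w = x.
Proof. exact: exists_submodule (subspace_kernel f). Qed.

Lemma exists_cokernel U V (f : {linear U -> V}) :
  exists W (p : {linear V -> W}),
    surjective p /\ forall y, p y = 0 <-> exists x, f x = y.
Proof. exact: exists_quotient (subspace_image f). Qed.

Lemma exists_image U V (f : {linear U -> V}) :
  exists W (q : {linear U -> W}) (i : {linear W -> V}),
    [/\ injective i, surjective q & forall x, i (q x) = f x].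
Proof.
have [W [i [ii iP]]] := exists_submodule (subspace_image f).
have [q qP] : exists q : {linear U -> W}, forall u, i (q u) = f u.
  by apply: lift_through_inj => // u; apply/iP; exists u.
exists W, q, i; split=> // w.
have /iP[x xw] : exists w', i w' = i w by exists w.
by exists x; apply: ii; rewrite qP.
Qed.

Lemma isomorphic_sym X Y : isomorphic X Y -> isomorphic Y X.
Proof. by case=> f /linear_bij_inv[g fK gK]; exists g; exists f. Qed.

Lemma surjective_fin_gen X Y (f : {linear X -> Y}) :
  surjective f -> fin_gen X -> fin_gen Y.
Proof.
move=> fs [n [v vP]]; exists n, (f \o v) => y.
have [x <-] := fs y; have [c ->] := vP x; exists c.
by rewrite linear_sum; apply: eq_bigr => i _; rewrite linearZ.
Qed.

Lemma is_zero_fin_gen X : is_zero X -> fin_gen X.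
Proof. by move=> X0; exists 0%N, (fun=> 0) => m; exists (fun=> 0); rewrite big_ord0. Qed.

Lemma fin_gen_prod X Y : fin_gen X -> fin_gen Y -> fin_gen (X * Y)%type.
Proof.
move=> [n [v vP]] [m [w wP]].
exists (n + m)%N, (fun i =>
  match fintype.split i with inl i => (v i, 0) | inr j => (0, w j) end).
move=> [x y]; have [c ->] := vP x; have [d ->] := wP y.
exists (fun i => match fintype.split i with inl i => c i | inr j => d j end).
have spl i : fintype.split (lshift m i) = inl i := unsplitK (inl i).
have spr j : fintype.split (rshift n j) = inr j := unsplitK (inr j).
rewrite big_split_ord [LHS]surjective_pairing [RHS]surjective_pairing.
congr pair; rewrite !raddfD !raddf_sum /=.
  rewrite [X in _ + X]big1 ?addr0; last by move=> j _; rewrite spr scaler0.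
  by apply: eq_bigr => i _; rewrite spl.
rewrite [X in X + _]big1 ?add0r; last by move=> i _; rewrite spl scaler0.
by apply: eq_bigr => j _; rewrite spr.
Qed.

Lemma indecomposable_internal U X Y (i : {linear X -> U}) (j : {linear Y -> U}) :
  indecomposable U -> injective i -> injective j ->
  (forall x y, i x = j y -> i x = 0) -> (forall u, exists x y, u = i x + j y) ->
  is_zero X \/ is_zero Y.
Proof.
move=> [_ _ Udec] ii ji ij0 ijU; apply: Udec; apply: isomorphic_sym.
have flin : linear (fun xy : X * Y => i xy.1 + j xy.2).
  by move=> a x y /=; rewrite !linearP scalerDr addrACA.
exists (mk_linear flin); apply: inj_surj_bij.
  apply: linear_inj0 => -[x y] /= /(canRL (addrK _)); rewrite add0r -linearN => e.
  have ix0 := ij0 _ _ e; have jy0 := etrans (esym e) ix0.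
  have -> : x = 0 by apply: ii; rewrite linear0.
  by move: jy0; rewrite linearN => /eqP; rewrite oppr_eq0 => /eqP jy0;
     have -> : y = 0 by apply: ji; rewrite linear0.
by move=> u; have [x [y ->]] := ijU u; exists (x, y).
Qed.

(** The module is the internal direct sum of the kernel and the image of e, so
    one of them vanishes. *)
Lemma indecomposable_idem U (e : {linear U -> U}) :
  indecomposable U -> (forall x, e (e x) = e x) ->
  (forall x, e x = 0) \/ (forall x, e x = x).
Proof.
move=> Uind ee.
have [X [i [ii iP]]] := exists_kernel e.
have [Y [j [ji jP]]] := exists_submodule (subspace_image e).
have [] := indecomposable_internal Uind ii ji.
- move=> x y xy; have ex : e (i x) = 0 by apply/iP; exists x.
  have [z ez] : exists z, e z = j y by apply/jP; exists y.
  by rewrite xy -ez -ee ez -xy.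
- move=> u; have [x xP] : exists x, i x = u - e u.
    by apply/iP; rewrite linearB ee subrr.
  have [y yP] : exists y, j y = e u by apply/jP; exists u.
  by exists x, y; rewrite xP yP subrK.
- move=> X0; right=> u; apply/eqP; rewrite eq_sym -subr_eq0; apply/eqP.
  have [x <-] : exists x, i x = u - e u by apply/iP; rewrite linearB ee subrr.
  by rewrite (X0 x) linear0.
- move=> Y0; left=> u; have [y <-] : exists y, j y = e u by apply/jP; exists u.
  by rewrite (Y0 y) linear0.
Qed.

(** The idempotent a r of X does not vanish since L is nonzero, so it is the
    identity: a retract of an indecomposable module is all of it. *)
Lemma retract_of_indecomposable (L X : lmodType R)
    (a : {linear L -> X}) (r : {linear X -> L}) :
  indecomposable X -> ~ is_zero L -> (forall x, r (a x) = x) -> cancel r a.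
Proof.
move=> Xind L0 ra.
have [] := @indecomposable_idem X (a \o r : {linear X -> X}) Xind.
- by move=> x /=; rewrite ra.
- move=> ar0; case: L0 => x; rewrite -(ra x) -(ra (r _)).
  by have /= -> := ar0 (a x); rewrite linear0.
- by [].
Qed.

End LinearMaps.

(** * Dimension over a field *)

Section Dimension.
Variable F : fieldType.
Implicit Types U V W : lmodType F.

Definition has_dim V n :=
  exists (W : vectType F) (f : {linear V -> W}), bijective f /\ \dim {:W} = n.

Definition fin_dim V := exists n, has_dim V n.

Lemma vect_has_dim (W : vectType F) : has_dim W (\dim {:W}).
Proof. by exists W, idfun; split=> //; exists id. Qed.

Lemma inj_vect_dim_le (W W' : vectType F) (f : {linear W -> W'}) :
  injective f -> (\dim {:W} <= \dim {:W'})%N.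
Proof.
move=> fi; have f0 : lker (linfun f) == 0%VS.
  by apply/lker0P => x y; rewrite !lfunE; apply: fi.
by rewrite -(limg_dim_eq (f := linfun f) (U := fullv)) ?(eqP f0) ?capv0 // dimvS // subvf.
Qed.

Lemma has_dim_fun V n m : has_dim V n -> has_dim V m -> n = m.
Proof.
move=> [W [f [fb <-]]] [W' [f' [fb' <-]]].
have [g fK gK] := linear_bij_inv fb; have [g' fK' gK'] := linear_bij_inv fb'.
apply/eqP; rewrite eqn_leq; apply/andP; split.
  by apply: (@inj_vect_dim_le _ _ (f' \o g : {linear W -> W'}));
     apply: inj_comp; [apply: can_inj fK' | apply: can_inj gK].
by apply: (@inj_vect_dim_le _ _ (f \o g' : {linear W' -> W}));
   apply: inj_comp; [apply: can_inj fK | apply: can_inj gK'].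
Qed.

(** A total function, with value 0 in infinite dimension, so that dimension
    counts need no proof of finiteness as an argument. *)
Definition kdim V : nat :=
  if pselect (fin_dim V) is left H then projT1 (cid H) else 0%N.

Lemma kdimP V : fin_dim V -> has_dim V (kdim V).
Proof. by rewrite /kdim; case: pselect => // H _; case: cid. Qed.

Lemma kdimE V n : has_dim V n -> kdim V = n.
Proof. by move=> Vn; apply: (has_dim_fun _ Vn); apply: kdimP; exists n. Qed.

(** Among the vspaces contained in P, one of maximal dimension must contain
    every w in P, since otherwise adding the line of w would enlarge it. *)
Lemma subspace_vspace (W : vectType F) (P : W -> Prop) :
  subspace P -> exists U : {vspace W}, forall w, w \in U <-> P w.
Proof.
move=> [P0 PD].
pose Q n := `[< exists U : {vspace W}, \dim U = n /\ forall w, w \in U -> P w >].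
have exQ : exists n, Q n.
  by exists 0%N; apply/asboolP; exists 0%VS; rewrite dimv0; split=> // w; rewrite memv0 => /eqP->.
have Qle n : Q n -> (n <= \dim {:W})%N.
  by move=> /asboolP[U [<- _]]; apply: dimvS; apply: subvf.
case: (ex_maxnP exQ Qle) => n /asboolP[U [dU UP]] nmax.
exists U => w; split; first exact: UP.
move=> Pw; have : Q (\dim (U + <[w]>)%VS).
  apply/asboolP; exists (U + <[w]>)%VS; split=> // _ /memv_addP[u uU [_ /vlineP[c ->] ->]].
  by rewrite addrC; apply: PD => //; apply: UP.
move/nmax => le_n.
have /eqP-> : U == (U + <[w]>)%VS by rewrite eqEdim addvSl dU.
by rewrite memvE addvSr.
Qed.

Lemma fin_dim_sub U V (i : {linear U -> V}) :
  injective i -> fin_dim V -> fin_dim U.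
Proof.
move=> ii [n [W [f [fb _]]]].
have [S SP] := subspace_vspace (subspace_image (f \o i : {linear U -> W})).
have vi : injective (vsval : subvs_of S -> W) by exact: val_inj.
have [g gP] : exists g : {linear U -> subvs_of S}, forall u, vsval (g u) = f (i u).
  apply: (lift_through_inj (i := vsval) (f := f \o i : {linear U -> W})) => // u.
  have uS : f (i u) \in S by apply/SP; exists u.
  by exists (Subvs uS).
exists (\dim {:subvs_of S}), (subvs_of S), g; split=> //.
apply: inj_surj_bij => [x y gxy|s].
  by apply: ii; apply: (bij_inj fb); rewrite -!gP gxy.
have /SP[u us] := subvsP s.
by exists u; apply: vi; rewrite gP.
Qed.

(** In coordinates the image of U is a vspace S, and p identifies W with a
    complement of S. *)
Lemma kdim_exact U V W (i : {linear U -> V}) (p : {linear V -> W}) :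
  short_exact i p -> fin_dim V ->
  [/\ fin_dim U, fin_dim W & kdim V = (kdim U + kdim W)%N].
Proof.
move=> [ii ps exact_ip] Vfd; have Ufd := fin_dim_sub ii Vfd.
have [X [f [fb dX]]] := kdimP Vfd; have [g fK gK] := linear_bij_inv fb.
have gb : bijective g by exists f.
have [S SP] := subspace_vspace (subspace_kernel (p \o g : {linear X -> W})).
have dU : has_dim U (\dim S).
  have [j jP] : exists j : {linear U -> subvs_of S}, forall u, vsval (j u) = f (i u).
    apply: (lift_through_inj (i := vsval) (f := f \o i : {linear U -> X})).
      exact: val_inj.
    move=> u; have uS : f (i u) \in S by apply/SP; rewrite /= fK exact_ip; exists u.
    by exists (Subvs uS).
  exists (subvs_of S), j; split; last first.
    rewrite dimvf. reflexivity.
  apply: inj_surj_bij => [x y jxy|s].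
    by apply: ii; apply: (bij_inj fb); rewrite -!jP jxy.
  have /SP /= := subvsP s; rewrite exact_ip => -[u us].
  by exists u; apply: val_inj; rewrite [LHS]jP us gK.
have dW : has_dim W (\dim S^C).
  pose q : {linear subvs_of S^C -> W} := p \o (g \o vsval).
  have qb : bijective q.
    apply: inj_surj_bij => [|w].
      apply: linear_inj0 => s qs0; have sC := subvsP s.
      have sS : vsval s \in S by apply/SP.
      apply: val_inj => /=; apply/eqP; rewrite -memv0 -(capv_compl S).
      by rewrite memv_cap sS.
    have [v <-] := ps w.
    have /memv_addP[a aS [b bC ab]] : f v \in (S + S^C)%VS by rewrite addv_complf memvf.
    exists (Subvs bC); rewrite /q /= -[v in RHS]fK ab linearD linearD.
    by have /SP /= -> := aS; rewrite add0r.
  have [q' qK q'K] := linear_bij_inv qb.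
  exists (subvs_of S^C), q'; split; first by exists q.
  by rewrite dimvf.
split=> //; first by eexists; exact: dW.
rewrite (kdimE dU) (kdimE dW) -dX -(addv_complf S) dimv_disjoint_sum //.
by rewrite capv_compl.
Qed.

Lemma fin_dim_quo V W (p : {linear V -> W}) :
  surjective p -> fin_dim V -> fin_dim W.
Proof.
move=> ps Vfd; have [K [i [ii iP]]] := exists_kernel p.
by have [] := kdim_exact (And3 ii ps iP) Vfd.
Qed.

Lemma kdim_eq0 V : fin_dim V -> kdim V = 0%N -> is_zero V.
Proof.
move=> Vfd V0; have [W [f [fb]]] := kdimP Vfd.
rewrite V0 => /eqP; rewrite dimv_eq0 => /eqP W0 v.
apply: (bij_inj fb); rewrite linear0; apply/eqP.
by rewrite -memv0 -W0 memvf.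
Qed.

Lemma kdim_iso V W (f : {linear V -> W}) : bijective f -> kdim V = kdim W.
Proof.
move=> fb; have [g fK gK] := linear_bij_inv fb.
have Hd n : has_dim V n -> has_dim W n.
  move=> [X [h [hb dX]]]; exists X, (h \o g); split=> //.
  by apply: bij_comp => //; exists f.
have Hd' n : has_dim W n -> has_dim V n.
  move=> [X [h [hb dX]]]; exists X, (h \o f); split=> //.
  exact: bij_comp.
rewrite /kdim; case: pselect => [H|nV]; case: pselect => [H'|nW] //.
- by apply: has_dim_fun (projT2 (cid H')); apply: Hd; case: cid.
- by case: nW; case: H => n /Hd; exists n.
- by case: nV; case: H' => n /Hd'; exists n.
Qed.

Lemma kdim_surj V W (f : {linear V -> W}) :
  fin_dim V -> surjective f -> ~ injective f -> (kdim W < kdim V)%N.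
Proof.
move=> Vfd fs fni; have [K [i [ii iP]]] := exists_kernel f.
have [Kfd Wfd ->] := kdim_exact (And3 ii fs iP) Vfd.
rewrite -[X in (X < _)%N]add0n ltn_add2r lt0n; apply/eqP => /(kdim_eq0 Kfd) K0.
by apply: fni; apply: linear_inj0 => x /iP[k <-]; rewrite (K0 k) linear0.
Qed.

Lemma kdim_inj V W (f : {linear V -> W}) :
  fin_dim W -> injective f -> ~ surjective f -> (kdim V < kdim W)%N.
Proof.
move=> Wfd fi fns; have [C [p [ps pP]]] := exists_cokernel f.
have [Vfd Cfd ->] := kdim_exact (And3 fi ps pP) Wfd.
rewrite -[X in (X < _)%N]addn0 ltn_add2l lt0n; apply/eqP => /(kdim_eq0 Cfd) C0.
by apply: fns => y; apply/pP; apply: C0.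
Qed.

Lemma fin_dim_basis V : fin_dim V ->
  exists n (v : 'I_n -> V) (c : 'I_n -> {linear V -> F^o}),
    (forall x, x = \sum_(i < n) c i x *: v i) /\
    forall (d : 'I_n -> F) i, c i (\sum_(j < n) d j *: v j) = d i.
Proof.
move=> [_ [W [f [fb _]]]]; have [g fK gK] := linear_bij_inv fb.
pose b := vbasis {:W}.
exists (\dim {:W}), (fun i => g b`_i), (fun i => coord b i \o f); split=> [x|d i] /=.
  rewrite -[LHS]fK {1}(coord_vbasis (memvf (f x))) linear_sum.
  by apply: eq_bigr => i _; rewrite linearZ.
have -> : f (\sum_j d j *: g b`_j) = \sum_j d j *: b`_j.
  by rewrite linear_sum; apply: eq_bigr => j _; rewrite linearZ gK.
have /andP[_ bfree] := vbasisP {:W}.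
rewrite linear_sum (bigD1 i) //= linearZ /= coord_free // eqxx mulr1 big1 ?addr0 // => j ji.
by rewrite linearZ /= coord_free // (negPf ji) mulr0.
Qed.

Lemma exists_section V W (p : {linear V -> W}) :
  surjective p -> fin_dim W -> exists s : {linear W -> V}, forall w, p (s w) = w.
Proof.
move=> ps /fin_dim_basis[n [v [c [vP _]]]]; have [t tP] := choice ps.
have slin : linear (fun w => \sum_(i < n) c i w *: t (v i)).
  move=> a x y; rewrite scaler_sumr -big_split; apply: eq_bigr => i _.
  by rewrite linearP scalerDl scalerA.
exists (mk_linear slin) => w; rewrite /= [RHS]vP linear_sum.
by apply: eq_bigr => i _; rewrite linearZ /= tP.
Qed.

(** Take finitely many elements of P whose span has maximal dimension. *)
Lemma finite_spanning_family V (P : V -> Prop) : fin_dim V ->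
  exists n (v : 'I_n -> V), (forall i, P (v i)) /\
    forall x, P x -> exists c : 'I_n -> F, x = \sum_(i < n) c i *: v i.
Proof.
move=> [_ [W [f [fb _]]]]; have [g fK gK] := linear_bij_inv fb.
pose Q n := `[< exists s : seq W, (forall w, w \in s -> P (g w)) /\ \dim <<s>>%VS = n >].
have exQ : exists n, Q n.
  by exists (\dim <<[::] : seq W>>%VS); apply/asboolP; exists [::].
have Qle n : Q n -> (n <= \dim {:W})%N.
  by move=> /asboolP[s [_ <-]]; apply: dimvS; apply: subvf.
case: (ex_maxnP exQ Qle) => n /asboolP[s [sP ds]] nmax.
exists (size s), (fun i => g s`_i); split=> [i|x Px]; first by apply/sP/mem_nth.
have fx : f x \in <<s>>%VS.
  have : Q (\dim <<f x :: s>>%VS).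
    apply/asboolP; exists (f x :: s); split=> // w; rewrite inE => /orP[/eqP->|/sP//].
    by rewrite fK.
  move/nmax; rewrite span_cons => le_n.
  have /eqP-> : <<s>>%VS == (<[f x]> + <<s>>)%VS by rewrite eqEdim addvSr ds.
  by rewrite memvE addvSl.
exists (fun i => coord (in_tuple s) i (f x)).
rewrite -[LHS]fK {1}(coord_span (X := in_tuple s) fx) linear_sum.
by apply: eq_bigr => i _; rewrite linearZ.
Qed.

End Dimension.

(** * Modules over a finite-dimensional algebra *)

Section FiniteDimensionalModules.
Variables (k : fieldType) (A : falgType k).
Implicit Types (X Y Z U L : lmodType A) (V W : lmodType k).

(** The underlying k-space of an A-module, c in k acting through c%:A. With this
    structure, klinear is literally linear. *)
Definition kmod X : Type := X.
HB.instance Definition _ X := GRing.Zmodule.on (kmod X).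

Section ScalarRestriction.
Variable X : lmodType A.
Definition kscale (c : k) (x : kmod X) : kmod X := (c%:A : A) *: (x : X).
Fact kscaleA a b x : kscale a (kscale b x) = kscale (a * b) x.
Proof. by rewrite /kscale scalerA mulr_algl scalerA. Qed.
Fact kscale1 : left_id 1 kscale.
Proof. by move=> x; rewrite /kscale !scale1r. Qed.
Fact kscaleDr : right_distributive kscale +%R.
Proof. by move=> a x y; rewrite /kscale scalerDr. Qed.
Fact kscaleDl x : {morph kscale^~ x : a b / a + b}.
Proof. by move=> a b; rewrite /kscale !scalerDl. Qed.
HB.instance Definition _ := GRing.Zmodule_isLmodule.Build k (kmod X)
  kscaleA kscale1 kscaleDr kscaleDl.
End ScalarRestriction.

Definition klin X Y (h : X -> Y) (hl : klinear h) : {linear kmod X -> kmod Y} :=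
  mk_linear (hl : linear (h : kmod X -> kmod Y)).

Definition res X Y (f : {linear X -> Y}) : {linear kmod X -> kmod Y} :=
  klin (linear_klinear f).

Lemma linear_klinear_of X Y (h : {linear kmod X -> kmod Y}) : klinear (h : X -> Y).
Proof. exact: (@linearP k (kmod X) (kmod Y) _ h). Qed.

Lemma klinear_sum X Y (h : X -> Y) (I : Type) (s : seq I) (F : I -> X) :
  klinear h -> h (\sum_(i <- s) F i) = \sum_(i <- s) h (F i).
Proof. by move=> hl; apply: (raddf_sum (klin hl)). Qed.

Lemma klinear0 X Y (h : X -> Y) : klinear h -> h 0 = 0.
Proof. by move=> hl; apply: (raddf0 (klin hl)). Qed.

Lemma klinearZ X Y (h : X -> Y) (c : k) x :
  klinear h -> h (c%:A *: x) = c%:A *: h x.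
Proof. by move=> hl; rewrite -[c%:A *: x]addr0 hl klinear0 // addr0. Qed.

Lemma klinear_sub X Y (h h' : X -> Y) :
  klinear h -> klinear h' -> klinear (fun x => h x - h' x).
Proof. by move=> hl hl' c x y; rewrite hl hl' scalerBr opprD addrACA. Qed.

Lemma fin_dim_prod V W : fin_dim V -> fin_dim W -> fin_dim (V * W)%type.
Proof.
move=> [_ [V' [f [fb _]]]] [_ [W' [g [gb _]]]].
have hl : linear (fun vw : V * W => (f vw.1, g vw.2)).
  by move=> a x y; rewrite /= !linearP.
exists (\dim (fullv : {vspace (V' * W')%type})), (V' * W')%type, (mk_linear hl); split=> //.
case: fb gb => f' fK f'K [g' gK g'K].
by exists (fun vw => (f' vw.1, g' vw.2)) => -[x y] /=; rewrite ?fK ?gK ?f'K ?g'K.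
Qed.

Lemma fin_dim_ffun V (I : finType) : fin_dim V -> fin_dim {ffun I -> V}.
Proof.
move=> [_ [V' [f [fb _]]]].
have hl : linear (fun v : {ffun I -> V} => [ffun i => f (v i)]).
  by move=> a x y; apply/ffunP => i; rewrite !ffunE linearP.
exists (\dim {:{ffun I -> V'}}), {ffun I -> V'}, (mk_linear hl); split=> //.
case: fb => f' fK f'K.
exists (fun v : {ffun I -> V'} => [ffun i => f' (v i)]) => v;
  by apply/ffunP => i; rewrite !ffunE ?fK ?f'K.
Qed.

Lemma fin_gen_fin_dim X : fin_gen X <-> fin_dim (kmod X).
Proof.
split=> [[n [v vP]]|/fin_dim_basis[n [v [c [vP _]]]]]; last first.
  by exists n, v => x; exists (fun i => (c i x)%:A); rewrite [LHS]vP.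
have hl : linear (fun a : {ffun 'I_n -> A} => \sum_(i < n) a i *: v i : kmod X).
  move=> c a b; rewrite scaler_sumr -big_split; apply: eq_bigr => i _ /=.
  by rewrite !ffunE scalerDl -[c *: (_ : kmod X)]/(c%:A *: (_ : X)) scalerA mulr_algl.
apply: (fin_dim_quo (p := mk_linear hl)).
  by move=> x; have [c ->] := vP x; exists (finfun c) => /=; apply: eq_bigr => i _; rewrite ffunE.
by apply: fin_dim_ffun; exists (\dim {:A}); apply: vect_has_dim.
Qed.

Lemma fin_gen_sub X Y (i : {linear X -> Y}) : injective i -> fin_gen Y -> fin_gen X.
Proof. by move=> ii; rewrite !fin_gen_fin_dim; apply: (fin_dim_sub (i := res i)). Qed.

Lemma klinear_section X Y (p : {linear X -> Y}) : surjective p -> fin_gen Y ->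
  exists s : Y -> X, klinear s /\ forall y, p (s y) = y.
Proof.
move=> ps /fin_gen_fin_dim Yfd.
have [s sP] := @exists_section k _ _ (res p) ps Yfd.
by exists s; split=> //; apply: linear_klinear_of.
Qed.

Lemma fin_gen_ffun X (I : finType) : fin_gen X -> fin_gen {ffun I -> X}.
Proof.
rewrite !fin_gen_fin_dim => Xfd.
have hl : linear (fun v : {ffun I -> kmod X} => v : kmod {ffun I -> X}).
  by move=> c x y; apply/ffunP => i; rewrite !ffunE.
apply: (fin_dim_quo (p := mk_linear hl)); last exact: fin_dim_ffun.
by move=> v; exists v.
Qed.

End FiniteDimensionalModules.

(** * Cocycles, extensions and the long exact sequence *)

Section Cocycles.
Variables (k : fieldType) (A : falgType k).
Implicit Types (X Y Z U V L T : lmodType A).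

(** The cocycles of the bar complex as plain functions. Together with bar_d0 they
    make the long exact sequence of Ext^1 accessible by lifting k-linear maps. *)
Definition is_cocycle U X (d : A -> U -> X) :=
  kbilinear d /\ forall a b t, d (a * b) t = a *: d b t + d a (b *: t).

Lemma is_cocycleP U X (d : A -> U -> X) : d \in cocycle U X <-> is_cocycle d.
Proof.
split=> [/cocycleP[dl d0]|[dl d0]]; last apply/cocycleP; split=> //.
  move=> a b t; have := congr1 (fun F => F a b t) d0.
  rewrite /bar_d1 addrAC => /(canRL (subrK _)) ->.
  by rewrite add0r.
apply/funext=> a; apply/funext=> b; apply/funext=> t.
by rewrite /bar_d1 d0 opprD addrA subrr add0r addNr.
Qed.

(** Ext^1(U, X) = 0, stated before passing to the quotient by coboundaries. *)
Definition ext_vanishes U X :=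
  forall d : A -> U -> X, is_cocycle d ->
  exists h : U -> X, klinear h /\ forall a t, d a t = bar_d0 h a t.

Lemma cocycle_pre U V X (d : A -> U -> X) (b : {linear V -> U}) :
  is_cocycle d -> is_cocycle (fun a t => d a (b t)).
Proof.
move=> [[dl dr] d0]; split; first split.
- by move=> a c x y; rewrite linearP dl.
- by move=> c a a' t; rewrite dr.
- by move=> a a' t; rewrite d0 linearZ.
Qed.

Lemma cocycle_post U X Y (d : A -> U -> X) (f : {linear X -> Y}) :
  is_cocycle d -> is_cocycle (fun a t => f (d a t)).
Proof.
move=> [[dl dr] d0]; split; first split.
- by move=> a c x y; rewrite dl linearP.
- by move=> c a a' t; rewrite dr linearP.
- by move=> a a' t; rewrite d0 linearD linearZ.
Qed.

Lemma cocycle_reflect U X Y (d : A -> U -> X) (i : {linear X -> Y}) :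
  injective i -> is_cocycle (fun a t => i (d a t)) -> is_cocycle d.
Proof.
move=> ii [[dl dr] d0]; split; first split.
- by move=> a c x y; apply: ii; rewrite dl linearP.
- by move=> c a a' t; apply: ii; rewrite dr linearP.
- by move=> a a' t; apply: ii; rewrite d0 linearD linearZ.
Qed.

Lemma cocycle_lift_inj U X Y (e : A -> U -> Y) (i : {linear X -> Y}) :
  injective i -> is_cocycle e -> (forall a t, exists x, i x = e a t) ->
  exists d : A -> U -> X, is_cocycle d /\ forall a t, i (d a t) = e a t.
Proof.
move=> ii ec eP.
have /choice[d dP] a : exists da : U -> X, forall t, i (da t) = e a t.
  exact: exists_choice (eP a).
exists d; split=> //.
apply: cocycle_reflect ii _.
by have -> : (fun a t => i (d a t)) = e by apply/funext=> a; apply/funext=> t.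
Qed.

Lemma klinear_reflect X Y Z (h : Z -> X) (i : {linear X -> Y}) :
  injective i -> klinear (fun z => i (h z)) -> klinear h.
Proof. by move=> ii hl c x y; apply: ii; rewrite hl linearP. Qed.

Lemma scaler_kA X (a : A) (c : k) (x : X) : a *: (c%:A *: x) = c%:A *: (a *: x).
Proof. by rewrite !scalerA mulr_algl mulr_algr. Qed.

Lemma bar_d0_cocycle U X (h : U -> X) : klinear h -> is_cocycle (bar_d0 h).
Proof.
move=> hl; split; first split.
- move=> a c x y; rewrite /bar_d0.
  have -> : a *: (c%:A *: x + y) = c%:A *: (a *: x) + a *: y.
    by rewrite scalerDr scaler_kA.
  by rewrite !hl scalerDr scaler_kA opprD addrACA scalerBr.
- move=> c a b t; rewrite /bar_d0.
  have scE Y (y : Y) : (c *: a + b) *: y = c%:A *: (a *: y) + b *: y.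
    by rewrite scalerDl scalerA mulr_algl.
  rewrite !scE hl.
  by rewrite opprD addrACA scalerBr.
- move=> a b t; rewrite /bar_d0 scalerBr !scalerA.
  by rewrite addrA subrK.
Qed.

Lemma cocycle_sub U X (d e : A -> U -> X) :
  is_cocycle d -> is_cocycle e -> is_cocycle (fun a t => d a t - e a t).
Proof.
move=> [[dl dr] d0] [[el er] e0]; split; first split.
- by move=> a c x y; rewrite dl el scalerBr opprD addrACA.
- by move=> c a a' t; rewrite dr er scalerBr opprD addrACA.
- by move=> a a' t; rewrite d0 e0 scalerBr opprD addrACA.
Qed.

Lemma linear_of_bar_d0 U X (h : U -> X) : klinear h ->
  (forall a t, bar_d0 h a t = 0) -> exists v : {linear U -> X}, forall t, v t = h t.
Proof.
move=> hl h0; have hlin : linear h.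
  move=> a x y; rewrite (klinearD hl); congr (_ + _); apply/eqP.
  by rewrite eq_sym -subr_eq0; apply/eqP/h0.
by exists (mk_linear hlin).
Qed.

Lemma bar_d0_post U X Y (h : U -> X) (f : {linear X -> Y}) a t :
  f (bar_d0 h a t) = bar_d0 (fun t => f (h t)) a t.
Proof. by rewrite /bar_d0 linearB linearZ. Qed.

Lemma bar_d0_linear U X (h : {linear U -> X}) a t : bar_d0 h a t = 0.
Proof. by rewrite /bar_d0 linearZ subrr. Qed.

Lemma bar_d0B U X (h h' : U -> X) a t :
  bar_d0 (fun t => h t - h' t) a t = bar_d0 h a t - bar_d0 h' a t.
Proof. by rewrite /bar_d0 scalerBr !opprD !opprK addrACA. Qed.

Section LongExactSequence.
Variables (U X' X X'' : lmodType A) (i : {linear X' -> X}) (p : {linear X -> X''}).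
Hypotheses (ip : short_exact i p) (X''fg : fin_gen X'').

(** Exactness at Hom(U, X''): composing u with a k-linear section of p gives a
    k-linear lift h of u. Its defect of A-linearity is a cocycle with values in X',
    hence the coboundary of some h', and h - i h' is an A-linear lift. *)
Lemma lift_of_ext_vanishes : ext_vanishes U X' ->
  forall u : {linear U -> X''}, exists v : {linear U -> X}, forall t, p (v t) = u t.
Proof.
have [ii ps ex] := ip; move=> extX' u.
have [s [sl sP]] := klinear_section ps X''fg.
pose h t := s (u t).
have hl : klinear h by apply: klinear_comp sl (linear_klinear u).
have [d [dc dE]] : exists d : A -> U -> X', is_cocycle d /\
    forall a t, i (d a t) = bar_d0 h a t.
  apply: cocycle_lift_inj => //; first exact: bar_d0_cocycle.
  by move=> a t; apply/ex; rewrite /bar_d0 linearB linearZ /h !sP linearZ subrr.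
have [h' [h'l h'E]] := extX' d dc.
have ih'l := klinear_comp (linear_klinear i) h'l.
have [v vE] : exists v : {linear U -> X}, forall t, v t = h t - i (h' t).
  apply: linear_of_bar_d0; first exact: klinear_sub.
  by move=> a t; rewrite bar_d0B -bar_d0_post -h'E dE subrr.
exists v => t; rewrite vE linearB /h sP.
by have -> : p (i (h' t)) = 0 by [apply/ex; exists (h' t)]; rewrite subr0.
Qed.

(** Exactness at Ext^1(U, X'): a cocycle in X' becomes the coboundary of some h
    in X, then p h is A-linear, and subtracting a lift of it to X moves h into X'. *)
Lemma ext_vanishes_sub :
  (forall u : {linear U -> X''}, exists v : {linear U -> X}, forall t, p (v t) = u t) ->
  ext_vanishes U X -> ext_vanishes U X'.
Proof.
have [ii ps ex] := ip; move=> lft extX d dc.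
have [h [hl hE]] := extX _ (cocycle_post i dc).
have phl := klinear_comp (linear_klinear p) hl.
have [u uE] : exists u : {linear U -> X''}, forall t, u t = p (h t).
  apply: linear_of_bar_d0 => // a t; rewrite -bar_d0_post -hE.
  by apply/ex; exists (d a t).
have [v vE] := lft u.
have [h' h'E] : exists h' : U -> X', forall t, i (h' t) = h t - v t.
  have hv t : exists x, i x = h t - v t by apply/ex; rewrite linearB vE uE subrr.
  exact: exists_choice hv.
exists h'; split.
  apply: klinear_reflect ii _.
  have -> : (fun z => i (h' z)) = (fun z => h z - v z) by apply/funext.
  by apply: klinear_sub => //; apply: linear_klinear.
move=> a t; apply: ii; rewrite hE bar_d0_post.
have -> : (fun t => i (h' t)) = (fun t => h t - v t) by apply/funext.
by rewrite bar_d0B bar_d0_linear subr0.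
Qed.

End LongExactSequence.

(** Right exactness of Ext^1(U, -), in the form: cocycles lift along surjections.
    Modules of projective dimension at most 1 have this property, which
    passes to direct summands at once, whereas a resolution does not. Since k-linear
    maps lift as well, the whole functor of cocycles is then exact. *)
Definition right_exact U :=
  forall X Y (p : {linear X -> Y}), fin_gen Y -> surjective p ->
  forall d : A -> U -> Y, is_cocycle d ->
  exists e : A -> U -> X, is_cocycle e /\ forall a t, p (e a t) = d a t.

Lemma ext_vanishes_quo U X Y (p : {linear X -> Y}) :
  right_exact U -> fin_gen Y -> surjective p -> ext_vanishes U X -> ext_vanishes U Y.
Proof.
move=> Ur Yfg ps extX d dc; have [e [ec eE]] := Ur _ _ p Yfg ps d dc.
have [h [hl hE]] := extX e ec; exists (fun t => p (h t)); split.
  exact: klinear_comp (linear_klinear p) hl.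
by move=> a t; rewrite -eE hE bar_d0_post.
Qed.

Section Retract.
Variables (U T : lmodType A) (i : {linear U -> T}) (r : {linear T -> U}).
Hypothesis ri : forall u, r (i u) = u.

Lemma right_exact_retract : right_exact T -> right_exact U.
Proof.
move=> Tr X Y p Yfg ps d dc.
have [e [ec eE]] := Tr _ _ p Yfg ps _ (cocycle_pre r dc).
exists (fun a t => e a (i t)); split; first exact: cocycle_pre.
by move=> a t; rewrite eE ri.
Qed.

Lemma ext_vanishes_retract X : ext_vanishes T X -> ext_vanishes U X.
Proof.
move=> extT d dc; have [h [hl hE]] := extT _ (cocycle_pre r dc).
exists (fun t => h (i t)); split; first exact: klinear_comp hl (linear_klinear i).
by move=> a t; rewrite -{1}(ri t) hE /bar_d0 linearZ.
Qed.
End Retract.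

Section ExtensionModule.
Variables (U Z : lmodType A) (d : A -> U -> Z).

(** The extension of U by Z with class d: the space Z x U with the twisted action
    a (z, u) = (a z + d a u, a u). The cocycle identity is associativity. *)
Definition ext_mod (dc : is_cocycle d) : Type := (Z * U)%type.
Variable dc : is_cocycle d.
HB.instance Definition _ := GRing.Zmodule.on (ext_mod dc).

Definition ext_scale (a : A) (x : ext_mod dc) : ext_mod dc :=
  (a *: x.1 + d a x.2, a *: x.2).

Lemma cocycle_addl a b t : d (a + b) t = d a t + d b t.
Proof. by have [[_ dr] _] := dc; have := dr 1 a b t; rewrite !scale1r. Qed.
Lemma cocycle_addr a t u : d a (t + u) = d a t + d a u.
Proof. by have [[dl _] _] := dc; apply: (klinearD (dl a)). Qed.
Lemma cocycle1 t : d 1 t = 0.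
Proof.
have [_ d0] := dc; have := d0 1 1 t; rewrite mulr1 !scale1r.
by rewrite -[LHS]addr0 => /addrI.
Qed.
Lemma cocycle_alg (c : k) t : d c%:A t = 0.
Proof.
have [[_ dr] _] := dc; have := dr c 1 0 t.
have d00 : d 0 t = 0.
  by have := cocycle_addl 0 0 t; rewrite addr0 -[LHS]addr0 => /addrI.
by rewrite addr0 d00 cocycle1 scaler0 addr0.
Qed.

Fact ext_scaleA a b x : ext_scale a (ext_scale b x) = ext_scale (a * b) x.
Proof.
have [_ d0] := dc; rewrite /ext_scale /= !scalerA; congr pair.
by rewrite scalerDr scalerA d0 addrA.
Qed.
Fact ext_scale1 : left_id 1 ext_scale.
Proof. by move=> [z u]; rewrite /ext_scale /= !scale1r cocycle1 addr0. Qed.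
Fact ext_scaleDr : right_distributive ext_scale +%R.
Proof.
move=> a [z u] [z' u']; rewrite /ext_scale /=; congr pair; last by rewrite scalerDr.
by rewrite scalerDr cocycle_addr addrACA.
Qed.
Fact ext_scaleDl x : {morph ext_scale^~ x : a b / a + b}.
Proof.
move=> a b; rewrite /ext_scale /=; congr pair; last by rewrite scalerDl.
by rewrite scalerDl cocycle_addl addrACA.
Qed.
HB.instance Definition _ := GRing.Zmodule_isLmodule.Build A (ext_mod dc)
  ext_scaleA ext_scale1 ext_scaleDr ext_scaleDl.

(** Every cocycle measures the failure of A-linearity of a k-linear section s of
    some extension. *)
Lemma exists_extension :
  exists (E : lmodType A) (i : {linear Z -> E}) (p : {linear E -> U}) (s : U -> E),
    [/\ short_exact i p, klinear s, forall u, p (s u) = u &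
        forall a u, bar_d0 s a u = i (d a u)].
Proof.
have d_r0 a : d a 0 = 0.
  by have := cocycle_addr a 0 0; rewrite addr0 -[LHS]addr0 => /addrI.
have ilin : linear (fun z => (z, 0) : ext_mod dc).
  move=> a x y; congr pair; last by rewrite /= scaler0 addr0.
  by rewrite /= d_r0 addr0.
have plin : linear (fun x : ext_mod dc => x.2) by [].
exists (ext_mod dc), (mk_linear ilin), (mk_linear plin), (fun u => (0, u)); split=> //.
- split=> [x y [] //|u|[z u]]; first by exists (0, u).
  by split=> [/= ->|[x [_ <-]]] //; exists z.
- move=> c x y; congr pair; rewrite /= scaler0 cocycle_alg.
  by rewrite !addr0.
- move=> a u; congr pair; rewrite /= ?scaler0 ?subrr //.
  by rewrite add0r subr0.
Qed.

End ExtensionModule.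

(** Let 0 -> P1 -> P0 -> T -> 0 be a projective resolution and s a k-linear
    section of P0 -> T. The defect of s is a cocycle c with values in P1, and it is
    universal: lifting P0 -> T to the extension with class d yields psi : P1 -> Y with
    d = psi c up to a coboundary. Along a surjection X -> Y, the map psi lifts as P1 is
    projective, and the coboundary lifts k-linearly. *)
Lemma pd_le1_right_exact T : fin_gen T -> pd_le1 T -> right_exact T.
Proof.
move=> Tfg [P1 [P0 [i [p [[_ P1proj] [_ P0proj] [ii ps ex]]]]]].
move=> X Y q Yfg qs d dc.
have [s [sl sP]] := klinear_section ps Tfg.
have [c [cc cE]] : exists c : A -> T -> P1, is_cocycle c /\
    forall a t, i (c a t) = bar_d0 s a t.
  apply: cocycle_lift_inj => //; first exact: bar_d0_cocycle.
  by move=> a t; apply/ex; rewrite bar_d0_post /bar_d0 !sP subrr.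
have [E [j [r [sg [[ji rs exE] sgl sgP sgE]]]]] := exists_extension dc.
have [phi phiE] := P0proj E T r p rs.
have [h hE] : exists h : T -> Y, forall t, j (h t) = phi (s t) - sg t.
  apply: (exists_choice (P := fun t y => j y = phi (s t) - sg t)) => t.
  apply/exE; rewrite linearB sgP.
  by have /= -> := phiE (s t); rewrite sP subrr.
have hl : klinear h.
  apply: klinear_reflect ji _.
  have -> : (fun z => j (h z)) = (fun z => phi (s z) - sg z) by apply/funext.
  by apply: klinear_sub => //; apply: klinear_comp sl; apply: linear_klinear.
have [psi psiE] : exists psi : {linear P1 -> Y}, forall x, j (psi x) = phi (i x).
  apply: (lift_through_inj (f := phi \o i : {linear P1 -> E})) => // x /=.
  by apply/exE; have /= -> := phiE (i x); apply/ex; exists x.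
(* On s t the lift phi differs from the section sg by h t; the defects of s and sg
   are c and d. *)
have dE a t : d a t = psi (c a t) - bar_d0 h a t.
  apply: ji; rewrite linearB psiE cE bar_d0_post bar_d0_post.
  have -> : (fun t => j (h t)) = (fun t => phi (s t) - sg t) by apply/funext.
  by rewrite bar_d0B opprB addrC subrK sgE.
have [psi' psi'E] := P1proj X Y q psi qs.
have [s' [s'l s'P]] := klinear_section qs Yfg.
have s'hl := klinear_comp s'l hl.
exists (fun a t => psi' (c a t) - bar_d0 (s' \o h) a t); split.
  apply: cocycle_sub; first exact: cocycle_post.
  exact: bar_d0_cocycle.
move=> a t; rewrite linearB bar_d0_post dE; have /= -> := psi'E (c a t).
by congr (_ - _); rewrite /bar_d0 !s'P.
Qed.

End Cocycles.

(** * The Euler form *)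

Section EulerForm.
Variables (k : fieldType) (A : falgType k).
Implicit Types (X Y Z U L T : lmodType A).

Lemma klinear_subspace U L : subspace (fun h : U -> kmod L => klinear (h : U -> L)).
Proof.
split; first by move=> c x y; rewrite scaler0 addr0.
move=> a h h' hl hl' c x y.
change ((a%:A : A) *: (h (c%:A *: x + y) : L) + (h' (c%:A *: x + y) : L) =
  c%:A *: (a%:A *: (h x : L) + (h' x : L)) + (a%:A *: (h y : L) + (h' y : L))).
by rewrite hl hl' !scalerDr addrACA scaler_kA.
Qed.

Lemma is_cocycle_subspace U L :
  subspace (fun d : A * U -> kmod L => is_cocycle (fun a u => d (a, u) : L)).
Proof.
split.
  split; first split.
  - by move=> a c x y; rewrite scaler0 addr0.
  - by move=> c a b t; rewrite scaler0 addr0.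
  - by move=> a b t; rewrite scaler0 addr0.
move=> a d d' [[dl dr] d0] [[dl' dr'] d0'].
have E b u : ((a *: d + d') (b, u) : kmod L) =
  (a%:A : A) *: (d (b, u) : L) + (d' (b, u) : L) by [].
split; first split.
- by move=> b c x y; rewrite !E dl dl' !scalerDr addrACA scaler_kA.
- by move=> c b b' t; rewrite !E dr dr' !scalerDr addrACA scaler_kA.
- by move=> b b' t; rewrite !E d0 d0' !scalerDr addrACA scaler_kA.
Qed.

Definition Homk U L : lmodType k := sub_module (subspace_pred (klinear_subspace U L)).
(** Cocycles are taken here as functions on A x U, so that they inherit the
    k-linear structure of a single function space. *)
Definition Zk U L : lmodType k := sub_module (subspace_pred (is_cocycle_subspace U L)).

Lemma Homk_klinear U L (h : Homk U L) : klinear (val h : U -> L).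
Proof. by have /asboolP := valP h. Qed.

Lemma mem_Homk U L (h : U -> L) : klinear h ->
  (h : U -> kmod L) \in (subspace_pred (klinear_subspace U L) : {pred U -> kmod L}).
Proof. by move=> hl; apply/asboolP. Qed.
Definition to_Homk U L (h : U -> L) (hl : klinear h) : Homk U L :=
  exist _ (h : U -> kmod L) (mem_Homk hl).

Lemma mem_Zk U L (d : A -> U -> L) : is_cocycle d ->
  ((fun au => d au.1 au.2) : A * U -> kmod L) \in
    (subspace_pred (is_cocycle_subspace U L) : {pred A * U -> kmod L}).
Proof. by move=> dl; apply/asboolP. Qed.
Definition to_Zk U L (d : A -> U -> L) (dc : is_cocycle d) : Zk U L :=
  exist _ ((fun au => d au.1 au.2) : A * U -> kmod L) (mem_Zk dc).

Definition hval U L (h : Homk U L) (u : U) : L := val h u.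
Definition zval U L (d : Zk U L) (a : A) (u : U) : L := val d (a, u).

Lemma Homk_eq U L (h h' : Homk U L) : (forall u, hval h u = hval h' u) -> h = h'.
Proof. by move=> hh'; apply: val_inj; apply/funext. Qed.
Lemma Zk_eq U L (d d' : Zk U L) : (forall a u, zval d a u = zval d' a u) -> d = d'.
Proof. by move=> dd'; apply: val_inj; apply/funext=> -[a u]; apply: dd'. Qed.
Lemma hval_lin U L c (h h' : Homk U L) u :
  hval (c *: h + h') u = c%:A *: hval h u + hval h' u.
Proof. by []. Qed.
Lemma zval_lin U L c (d d' : Zk U L) a u :
  zval (c *: d + d') a u = c%:A *: zval d a u + zval d' a u.
Proof. by []. Qed.
Lemma hval0 U L u : hval (0 : Homk U L) u = 0. Proof. by []. Qed.
Lemma zval0 U L a u : zval (0 : Zk U L) a u = 0. Proof. by []. Qed.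
Lemma hval_to U L (h : U -> L) (hl : klinear h) : hval (to_Homk hl) = h.
Proof. by []. Qed.
Lemma zval_to U L (d : A -> U -> L) (dc : is_cocycle d) : zval (to_Zk dc) = d.
Proof. by []. Qed.
Lemma hval_klinear U L (h : Homk U L) : klinear (hval h).
Proof. exact: Homk_klinear. Qed.
Lemma zval_cocycle U L (d : Zk U L) : is_cocycle (zval d).
Proof. by have /asboolP := valP d. Qed.

Section Push.
Variables (U X Y : lmodType A) (f : {linear X -> Y}).

Definition Homk_push (h : Homk U X) : Homk U Y :=
  to_Homk (klinear_comp (linear_klinear f) (hval_klinear h)).
Lemma Homk_pushE h u : hval (Homk_push h) u = f (hval h u).
Proof. by []. Qed.
Fact Homk_push_linear : linear Homk_push.
Proof.
by move=> c h h'; apply: Homk_eq => u; rewrite hval_lin !Homk_pushE hval_lin linearP.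
Qed.

Definition Zk_push (d : Zk U X) : Zk U Y := to_Zk (cocycle_post f (zval_cocycle d)).
Lemma Zk_pushE d a u : zval (Zk_push d) a u = f (zval d a u).
Proof. by []. Qed.
Fact Zk_push_linear : linear Zk_push.
Proof.
by move=> c d d'; apply: Zk_eq => a u; rewrite zval_lin !Zk_pushE zval_lin linearP.
Qed.
End Push.

Definition Homk_d U X (h : Homk U X) : Zk U X := to_Zk (bar_d0_cocycle (hval_klinear h)).
Lemma Homk_dE U X (h : Homk U X) a u : zval (Homk_d h) a u = bar_d0 (hval h) a u.
Proof. by []. Qed.
Fact Homk_d_linear U X : linear (@Homk_d U X).
Proof.
move=> c h h'; apply: Zk_eq => a u; rewrite zval_lin !Homk_dE /bar_d0 !hval_lin.
by rewrite scalerDr scaler_kA opprD addrACA scalerBr.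
Qed.

Lemma fin_gen_span_k X : fin_gen X -> exists n (v : 'I_n -> X),
  forall x, exists c : 'I_n -> k, x = \sum_(i < n) (c i)%:A *: v i.
Proof.
move=> /fin_gen_fin_dim/fin_dim_basis[n [v [c [vP _]]]].
by exists n, v => x; exists (c^~ x).
Qed.

Lemma klinear_eq_on n U L (v : 'I_n -> U) (h h' : U -> L) :
  (forall x, exists c : 'I_n -> k, x = \sum_(i < n) (c i)%:A *: v i) ->
  klinear h -> klinear h' -> (forall i, h (v i) = h' (v i)) -> h = h'.
Proof.
move=> vP hl hl' hh'; apply/funext=> x; have [c ->] := vP x.
rewrite !klinear_sum //; apply: eq_bigr => i _.
by rewrite !klinearZ // hh'.
Qed.

Lemma fin_dim_Homk U L : fin_gen U -> fin_gen L -> fin_dim (Homk U L).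
Proof.
move=> /fin_gen_span_k[n [v vP]] /fin_gen_fin_dim Lfd.
have hl : linear (fun h : Homk U L => [ffun i => hval h (v i)] : {ffun 'I_n -> kmod L}).
  by move=> c h h'; apply/ffunP => i; rewrite !ffunE hval_lin.
apply: (fin_dim_sub (i := mk_linear hl)); last exact: fin_dim_ffun.
move=> h h' /ffunP hh'; apply: Homk_eq => u.
suff -> : hval h = hval h' by [].
apply: (klinear_eq_on vP (hval_klinear h) (hval_klinear h')) => i.
by have := hh' i; rewrite !ffunE.
Qed.

Lemma fin_gen_regular : @fin_gen A A^o.
Proof.
exists 1%N, (fun=> 1) => a; exists (fun=> a).
by rewrite big_ord1 -[RHS]/(a * 1) mulr1.
Qed.

(** A cocycle is bilinear, so it is determined by its values on pairs of elements
    of generating families of A and U. *)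
Lemma fin_dim_Zk U L : fin_gen U -> fin_gen L -> fin_dim (Zk U L).
Proof.
move=> Ufg /fin_gen_fin_dim Lfd.
have [n [v vP]] := fin_gen_span_k Ufg.
have [m [b bP]] := fin_gen_span_k fin_gen_regular.
have hl : linear (fun d : Zk U L =>
    [ffun ij => zval d (b ij.1) (v ij.2)] : {ffun 'I_m * 'I_n -> kmod L}).
  by move=> c h h'; apply/ffunP => i; rewrite !ffunE zval_lin.
apply: (fin_dim_sub (i := mk_linear hl)); last exact: fin_dim_ffun.
move=> d d' /ffunP dd'; apply: Zk_eq => a u.
suff -> : zval d a = zval d' a by [].
have [[dl dr] _] := zval_cocycle d; have [[dl' dr'] _] := zval_cocycle d'.
apply: (klinear_eq_on vP (dl a) (dl' a)) => j.
have kl e (ec : is_cocycle e) : klinear (fun a : A^o => (e (a : A) (v j) : L)).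
  case: ec => -[_ er] _ c x y.
  by rewrite -[_ + _ : A^o]/((c%:A * (x : A)) + (y : A)) mulr_algl er.
suff /(congr1 (fun F => F a)) :
  (fun a : A^o => zval d (a : A) (v j)) = (fun a => zval d' a (v j)) by [].
apply: (klinear_eq_on bP (kl _ (zval_cocycle d)) (kl _ (zval_cocycle d'))) => i.
by have := dd' (i, j); rewrite !ffunE.
Qed.

(** Since bar_d0 : Hom_k(U, L) -> Z^1(U, L) has kernel Hom_A(U, L) and cokernel
    Ext^1(U, L), this is dim Hom_A(U, L) - dim Ext^1(U, L). Written in this way it is
    additive in L as soon as cocycles lift along surjections. *)
Definition euler U L : rat := (kdim (Homk U L))%:R - (kdim (Zk U L))%:R.

Lemma euler_exact U X' X X'' (i : {linear X' -> X}) (p : {linear X -> X''}) :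
  fin_gen U -> right_exact U -> short_exact i p -> fin_gen X ->
  euler U X = euler U X' + euler U X''.
Proof.
move=> Ufg Ur [ii ps ex] Xfg.
have X''fg := surjective_fin_gen ps Xfg.
have homE : kdim (Homk U X) = (kdim (Homk U X') + kdim (Homk U X''))%N.
  have [||_ _ ->//] := @kdim_exact _ _ _ _ (mk_linear (@Homk_push_linear U _ _ i))
    (mk_linear (@Homk_push_linear U _ _ p)); last exact: fin_dim_Homk.
  split.
  - move=> h h' hh'; apply: Homk_eq => u; apply: ii; rewrite -!Homk_pushE.
    exact: (congr1 (fun F => hval F u) hh').
  - move=> h; have [s [sl sP]] := klinear_section ps X''fg.
    exists (to_Homk (klinear_comp sl (hval_klinear h))); apply: Homk_eq => u.
    by rewrite Homk_pushE hval_to /= sP.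
  - move=> h; split=> [ph0|[h' <-]].
      have h'P u : exists x, i x = hval h u.
        apply/ex; rewrite -Homk_pushE.
        exact: (congr1 (fun F => hval F u) ph0).
      have [h' h'E] := exists_choice h'P.
      have h'l : klinear h'.
        apply: klinear_reflect ii _.
        by rewrite (_ : (fun z => _) = hval h); [apply: hval_klinear | apply/funext].
      by exists (to_Homk h'l); apply: Homk_eq => u; rewrite Homk_pushE hval_to h'E.
    apply: Homk_eq => u; rewrite hval0 !Homk_pushE; apply/ex; by exists (hval h' u).
have ZE : kdim (Zk U X) = (kdim (Zk U X') + kdim (Zk U X''))%N.
  have [||_ _ ->//] := @kdim_exact _ _ _ _ (mk_linear (@Zk_push_linear U _ _ i))
    (mk_linear (@Zk_push_linear U _ _ p)); last exact: fin_dim_Zk.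
  split.
  - move=> h h' hh'; apply: Zk_eq => a u; apply: ii; rewrite -!Zk_pushE.
    exact: (congr1 (fun F => zval F a u) hh').
  - move=> d; have [e [ec eE]] := Ur _ _ p X''fg ps _ (zval_cocycle d).
    exists (to_Zk ec); apply: Zk_eq => a u.
    by rewrite Zk_pushE zval_to eE.
  - move=> d; split=> [pd0|[d' <-]].
      have eP a u : exists x, i x = zval d a u.
        apply/ex; rewrite -Zk_pushE.
        exact: (congr1 (fun F => zval F a u) pd0).
      have [e [ec eE]] := cocycle_lift_inj ii (zval_cocycle d) eP.
      exists (to_Zk ec); apply: Zk_eq => a u.
      by rewrite Zk_pushE zval_to eE.
    apply: Zk_eq => a u; rewrite zval0 !Zk_pushE; apply/ex.
    by exists (zval d' a u).
by rewrite /euler homE ZE !natrD opprD addrACA.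
Qed.

Lemma euler_zero U L : fin_gen U -> right_exact U -> is_zero L -> euler U L = 0.
Proof.
move=> Ufg Ur L0.
have : short_exact (idfun : {linear L -> L}) (idfun : {linear L -> L}).
  split=> // [y|y]; first by exists y.
  by split=> _; [exists y | apply: L0].
move=> /(euler_exact Ufg Ur) /(_ (is_zero_fin_gen L0)) /eqP.
by rewrite -subr_eq subrr eq_sym => /eqP.
Qed.

Lemma euler_iso U X Y : fin_gen U -> right_exact U -> fin_gen X ->
  isomorphic X Y -> euler U X = euler U Y.
Proof.
move=> Ufg Ur Xfg [f fb].
have [K [i [ii iP]]] := exists_kernel f.
rewrite (euler_exact Ufg Ur (And3 ii (bij_surj fb) iP) Xfg) euler_zero ?add0r //.
move=> z; apply: ii; apply: (bij_inj fb); rewrite !linear0.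
by apply/iP; exists z.
Qed.

Lemma Homk_d_inj U L :
  (forall u : {linear U -> L}, forall x, u x = 0) -> injective (@Homk_d U L).
Proof.
move=> hom0; pose D := mk_linear (@Homk_d_linear U L).
apply: (linear_inj0 (f := D)) => h h0; apply: Homk_eq => x.
have [v vE] : exists v : {linear U -> L}, forall t, v t = hval h t.
  apply: (linear_of_bar_d0 (hval_klinear h)) => a t.
  by rewrite -Homk_dE; apply: (congr1 (fun F => zval F a t) h0).
by rewrite -vE hom0 hval0.
Qed.

Lemma Homk_d_surj U L : ext_vanishes U L <-> surjective (@Homk_d U L).
Proof.
split=> [ext0 d|ds d dc].
  have [h [hl hE]] := ext0 _ (zval_cocycle d).
  exists (to_Homk hl); apply: Zk_eq => a t.
  by rewrite Homk_dE hE.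
have [h hd] := ds (to_Zk dc); exists (hval h); split; first exact: hval_klinear.
by move=> a t; rewrite -Homk_dE hd zval_to.
Qed.

Lemma euler_eq0 U L : fin_gen U -> fin_gen L ->
  (forall u : {linear U -> L}, forall x, u x = 0) -> ext_vanishes U L ->
  euler U L = 0.
Proof.
move=> Ufg Lfg hom0 /Homk_d_surj ds; pose D := mk_linear (@Homk_d_linear U L).
rewrite /euler (kdim_iso (f := D)) ?subrr //.
by apply: inj_surj_bij => //; apply: Homk_d_inj.
Qed.

Lemma euler_hom_neq0 U L : fin_gen U -> fin_gen L -> ext_vanishes U L ->
  (exists u : {linear U -> L}, exists x, u x <> 0) -> euler U L != 0.
Proof.
move=> Ufg Lfg /Homk_d_surj ds [u [x ux]].
pose D := mk_linear (@Homk_d_linear U L).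
have lt : ~ injective D -> (kdim (Zk U L) < kdim (Homk U L))%N.
  by apply: kdim_surj; [apply: fin_dim_Homk | apply: ds].
rewrite subr_eq0 Num.Theory.eqr_nat neq_ltn orbC lt //.
move=> Di; apply: ux.
have : to_Homk (linear_klinear u) = 0.
  apply: Di; rewrite linear0; apply: Zk_eq => a t; rewrite Homk_dE zval0.
  exact: bar_d0_linear.
by move=> /(congr1 (fun F => hval F x)); rewrite hval_to hval0.
Qed.

Lemma euler_ext_neq0 U L : fin_gen U -> fin_gen L -> ~ ext_vanishes U L ->
  (forall u : {linear U -> L}, forall x, u x = 0) -> euler U L != 0.
Proof.
move=> Ufg Lfg next hom0; pose D := mk_linear (@Homk_d_linear U L).
have lt : (kdim (Homk U L) < kdim (Zk U L))%N.
  apply: (kdim_inj (f := D)); [exact: fin_dim_Zk | exact: Homk_d_inj hom0 |].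
  by move=> ds; apply: next; apply/Homk_d_surj.
by rewrite subr_eq0 Num.Theory.eqr_nat neq_ltn lt.
Qed.

End EulerForm.

(** * Decompositions and Fitting's lemma *)

Section FiniteLength.
Variables (k : fieldType) (A : falgType k).
Implicit Types (X Y Z U L T : lmodType A).

Definition adim X := kdim (kmod X).

Lemma adim_exact X' X X'' (i : {linear X' -> X}) (p : {linear X -> X''}) :
  short_exact i p -> fin_gen X -> adim X = (adim X' + adim X'')%N.
Proof.
move=> [ii ps ex] /fin_gen_fin_dim Xfd.
have rip : short_exact (res i) (res p) by [].
by rewrite /adim; have [_ _ ->] := kdim_exact rip Xfd.
Qed.

Lemma adim_eq0 X : fin_gen X -> adim X = 0%N -> is_zero X.
Proof. by move=> /fin_gen_fin_dim; apply: kdim_eq0. Qed.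

Lemma adim_inj X Y (f : {linear X -> Y}) :
  fin_gen Y -> injective f -> ~ surjective f -> (adim X < adim Y)%N.
Proof. by move=> /fin_gen_fin_dim Yfd; apply: (kdim_inj (f := res f)). Qed.

Lemma adim_surj X Y (f : {linear X -> Y}) :
  fin_gen X -> surjective f -> ~ injective f -> (adim Y < adim X)%N.
Proof. by move=> /fin_gen_fin_dim Xfd; apply: (kdim_surj (f := res f)). Qed.

Lemma endo_inj_bij X (f : {linear X -> X}) : fin_gen X -> injective f -> bijective f.
Proof.
move=> Xfg fi; apply: inj_surj_bij => //; apply: contrapT => fns.
by have := adim_inj Xfg fi fns; rewrite ltnn.
Qed.

Lemma endo_surj_bij X (f : {linear X -> X}) : fin_gen X -> surjective f -> bijective f.
Proof.
move=> Xfg fs; apply: inj_surj_bij => //; apply: contrapT => fni.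
by have := adim_surj Xfg fs fni; rewrite ltnn.
Qed.

(** Induction on the dimension. The decomposition is given by inclusions and
    projections, the form in which it is inserted into composites. *)
Lemma exists_decomposition X : fin_gen X ->
  exists (I : finType) (W : I -> lmodType A)
    (i : forall j, {linear W j -> X}) (p : forall j, {linear X -> W j}),
    [/\ forall j, indecomposable (W j), forall j w, p j (i j w) = w &
        forall x, x = \sum_j i j (p j x)].
Proof.
have [m] := ubnP (adim X); elim: m X => // m IHm X; rewrite ltnS => Xm Xfg.
have [X0|X0] := pselect (is_zero X).
  exists void, (fun=> X), (fun=> idfun), (fun=> idfun).
  by split=> [[]|[]|x]; rewrite big_pred0 // => -[].
have [Xind|Xdec] := pselect (indecomposable X).
  exists unit, (fun=> X), (fun=> idfun), (fun=> idfun); split=> // x.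
  by rewrite (big_pred1 tt) // => -[].
have [Y [Z [[f fb] Y0 Z0]]] : exists Y Z,
    [/\ isomorphic X (Y * Z)%type, ~ is_zero Y & ~ is_zero Z].
  apply: contrapT => noYZ; apply: Xdec; split=> // Y Z XYZ.
  apply: contrapT => /not_orP[Y0 Z0]; apply: noYZ; by exists Y, Z.
have [g fK gK] := linear_bij_inv fb.
have iYlin : linear (fun y : Y => g (y, 0)).
  by move=> a x y; rewrite -linearP; congr (g _); congr pair; rewrite /= ?scaler0 ?addr0.
have iZlin : linear (fun z : Z => g (0, z)).
  by move=> a x y; rewrite -linearP; congr (g _); congr pair; rewrite /= ?scaler0 ?addr0.
have pYlin : linear (fun x => (f x).1) by move=> a x y; rewrite linearP.
have pZlin : linear (fun x => (f x).2) by move=> a x y; rewrite linearP.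
pose iY := mk_linear iYlin; pose iZ := mk_linear iZlin.
pose pY := mk_linear pYlin; pose pZ := mk_linear pZlin.
have pYi y : pY (iY y) = y by rewrite /= gK.
have pZi z : pZ (iZ z) = z by rewrite /= gK.
have ipE x : x = iY (pY x) + iZ (pZ x).
  rewrite /= -linearD -[LHS]fK; congr (g _).
  by rewrite [LHS]surjective_pairing; congr pair; rewrite /= ?addr0 ?add0r.
have pYZ z : pY (iZ z) = 0 by rewrite /= gK.
have pZY y : pZ (iY y) = 0 by rewrite /= gK.
have Yfg : fin_gen Y by apply: (surjective_fin_gen (f := pY)) Xfg => y; exists (iY y).
have Zfg : fin_gen Z by apply: (surjective_fin_gen (f := pZ)) Xfg => z; exists (iZ z).
have sesYZ : short_exact iY pZ.
  split=> [y y' /(congr1 pY)|z|x]; first by rewrite !pYi.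
    by exists (iZ z).
  split=> [pz0|[y <-]] //; exists (pY x).
  by rewrite [RHS]ipE pz0 linear0 addr0.
have dX := adim_exact sesYZ Xfg.
have dY : (0 < adim Y)%N by rewrite lt0n; apply/eqP => /(adim_eq0 Yfg).
have dZ : (0 < adim Z)%N by rewrite lt0n; apply/eqP => /(adim_eq0 Zfg).
have Ym : (adim Y < m)%N.
  by apply: leq_trans Xm; rewrite dX -[X in (X < _)%N]addn0 ltn_add2l.
have Zm : (adim Z < m)%N.
  by apply: leq_trans Xm; rewrite dX -[X in (X < _)%N]add0n ltn_add2r.
have [I [W [i [p [Wind pi ipW]]]]] := IHm Y Ym Yfg.
have [J [V [j [q [Vind qj jqV]]]]] := IHm Z Zm Zfg.
pose WV (s : I + J) : lmodType A := match s with inl a => W a | inr b => V b end.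
pose ij s : {linear WV s -> X} := match s return {linear WV s -> X} with
  | inl a => iY \o i a | inr b => iZ \o j b end.
pose pq s : {linear X -> WV s} := match s return {linear X -> WV s} with
  | inl a => p a \o pY | inr b => q b \o pZ end.
exists (I + J)%type, WV, ij, pq; split.
- by case.
- by move=> [a|b] w; rewrite /ij /pq /= gK /= ?pi ?qj.
- move=> x; rewrite big_sumType [LHS]ipE; congr (_ + _).
    by rewrite [in LHS](ipW (pY x)) linear_sum.
  by rewrite [in LHS](jqV (pZ x)) linear_sum.
Qed.

(** A nonzero submodule of least dimension is simple. *)
Lemma exists_simple_submodule L : fin_gen L -> ~ is_zero L ->
  exists (S : lmodType A) (i : {linear S -> L}), injective i /\ simple_module S.
Proof.
move=> Lfg L0.
pose Q n := `[< exists (S : lmodType A) (i : {linear S -> L}),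
  [/\ injective i, ~ is_zero S & adim S = n] >].
have exQ : exists n, Q n by exists (adim L); apply/asboolP; exists L, idfun.
case: (ex_minnP exQ) => n /asboolP[S [i [ii S0 dS]]] nmin.
exists S, i; split=> //; split=> // P Pcl.
have Psub : subspace (fun x => x \in P).
  by case: Pcl => P0 PD; split=> // a x y; apply: PD.
have [W [j [ji jP]]] := exists_submodule Psub.
have [W0|W0] := pselect (is_zero W).
  by left=> x /jP[w <-]; rewrite (W0 w) linear0.
right=> x; apply/jP; apply: contrapT => nx.
have : (adim W < adim S)%N.
  apply: (adim_inj (f := j)) => //; first exact: fin_gen_sub ii Lfg.
rewrite dS ltnNge => /negP; apply; apply: nmin; apply/asboolP.
by exists W, (i \o j); split=> //; apply: inj_comp.
Qed.

Lemma iter_linear X (e : {linear X -> X}) n :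
  exists f : {linear X -> X}, forall x, f x = iter n e x.
Proof.
elim: n => [|n [f fE]]; first by exists idfun.
by exists (e \o f) => x; rewrite /= fE.
Qed.

(** Choose n so that the image W of e^(n+1) has least dimension. Then e^(n+1) maps
    W onto itself, hence bijectively, so that U is the direct sum of W and the kernel
    of e^(n+1). If the kernel vanished, e would be injective, hence bijective; so W
    vanishes. *)
Lemma fitting U (e : {linear U -> U}) : indecomposable U -> ~ bijective e ->
  exists n, forall x, iter n e x = 0.
Proof.
move=> Uind nb; have [Ufg _ _] := Uind.
pose Q r := `[< exists n (W : lmodType A) (i : {linear W -> U}),
  [/\ injective i, adim W = r &
      forall x, (exists w, i w = x) <-> (exists y, iter n.+1 e y = x)] >].
have imW n : exists (W : lmodType A) (i : {linear W -> U}), injective i /\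
    forall x, (exists w, i w = x) <-> (exists y, iter n e y = x).
  have [f fE] := iter_linear e n.
  have [W [i [ii iP]]] := exists_submodule (subspace_image f).
  exists W, i; split=> // x; rewrite -iP.
  by split=> -[y <-]; exists y.
have exQ : exists r, Q r.
  have [W [i [ii iP]]] := imW 1%N.
  by exists (adim W); apply/asboolP; exists 0%N, W, i.
case: (ex_minnP exQ) => r /asboolP[n [W [i [ii dW iP]]]] rmin.
have [f fE] := iter_linear e n.+1.
(* The image of e^(2n+2) lies in that of e^(n+1) and has at least its dimension. *)
have im2 x : (exists y, f y = x) -> exists y, f (f y) = x.
  move=> [y yx].
  have [W' [i' [ii' iP']]] := imW (n.+1 + n.+1)%N.
  have [j jE] : exists j : {linear W' -> W}, forall w, i (j w) = i' w.
    apply: lift_through_inj => // w; apply/iP.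
    have /iP'[z <-] : exists w', i' w' = i' w by exists w.
    by exists (iter n.+1 e z); rewrite -iterD.
  have ji : injective j by move=> a b ab; apply: ii'; rewrite -!jE ab.
  have js : surjective j.
    apply: contrapT => /(adim_inj (fin_gen_sub ii Ufg) ji).
    rewrite dW ltnNge => /negP; apply; apply: rmin; apply/asboolP.
    by exists (n + n.+1)%N, W', i'.
  have [w iw] : exists w, i w = x by apply/iP; exists y; rewrite -fE.
  have [w' w'E] := js w.
  have /iP'[z zE] : exists w', i' w' = x by exists w'; rewrite -jE w'E.
  by exists z; rewrite !fE -iterD.
(* The restriction of f = e^(n+1) to its image W is onto by minimality. *)
have [g gE] : exists g : {linear W -> W}, forall w, i (g w) = f (i w).
  apply: (lift_through_inj (f := f \o i)) => // w /=.
  by apply/iP; exists (i w); rewrite fE.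
have gs : surjective g.
  move=> w; have [y yE] : exists y, f (f y) = i w.
    apply: im2; have /iP[y yE] : exists w', i w' = i w by exists w.
    by exists y; rewrite fE.
  have [w' w'E] : exists w', i w' = f y by apply/iP; exists y; rewrite fE.
  by exists w'; apply: ii; rewrite gE w'E.
have gi := bij_inj (endo_surj_bij (fin_gen_sub ii Ufg) gs).
have [K [j [ji jP]]] := exists_kernel f.
have [] := indecomposable_internal Uind ii ji.
- move=> w z wz; have fw : f (i w) = 0 by apply/jP; exists z.
  have -> : w = 0 by apply: gi; apply: ii; rewrite gE fw !linear0.
  by rewrite linear0.
- move=> u; have [y yE] : exists y, f (f y) = f u by apply: im2; exists u.
  have [w wE] : exists w, i w = f y by apply/iP; exists y; rewrite fE.
  have [z zE] : exists z, j z = u - f y by apply/jP; rewrite linearB yE subrr.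
  by exists w, z; rewrite wE zE addrC subrK.
- move=> W0; exists n.+1 => x; rewrite -fE.
  have [w <-] : exists w, i w = f x by apply/iP; exists x; rewrite fE.
  by rewrite (W0 w) linear0.
- move=> K0; case: nb; apply: endo_inj_bij => //.
  apply: linear_inj0 => x ex.
  have [z <-] : exists z, j z = x.
    by apply/jP; rewrite fE iterSr ex; elim: (n) => [|m] /= => [|->] //; apply: linear0.
  by rewrite (K0 z) linear0.
Qed.

End FiniteLength.

(** * The torsion pair of a rigid module *)

Section Orthogonality.
Variables (k : fieldType) (A : falgType k).
Implicit Types (X Y Z U L T W R K S : lmodType A).

Lemma nilpotent_one_sub X (e f : {linear X -> X}) n : fin_gen X ->
  (forall x, iter n e x = 0) -> (forall x, f x = x - e x) -> bijective f.
Proof.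
move=> Xfg en fE; apply: endo_inj_bij => //; apply: linear_inj0 => x.
rewrite fE => /eqP; rewrite subr_eq0 => /eqP ex.
by rewrite -(en x); elim: n {en} => //= m <-.
Qed.

(** The endomorphism ring of U is local. If the first summand e0 is not bijective,
    then e0 u^-1 is nilpotent by Fitting's lemma, hence 1 - e0 u^-1 is bijective, and so
    is the sum of the remaining terms. *)
Lemma bijective_summand U s (e : 'I_s -> {linear U -> U}) (u : {linear U -> U}) :
  indecomposable U -> bijective u -> (forall x, u x = \sum_l e l x) ->
  exists l, bijective (e l).
Proof.
move=> Uind; have [Ufg U0 _] := Uind.
elim: s e u => [|s IHs] e u ub uE.
  by case: U0 => x; apply: (bij_inj ub); rewrite linear0 uE big_ord0.
have [e0|e0] := pselect (bijective (e ord0)); first by exists ord0.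
have [v uK vK] := linear_bij_inv ub.
have vb : bijective v by exists u.
have ev_nb : ~ bijective (e ord0 \o v : {linear U -> U}).
  by move=> ev; apply: e0; apply: (eq_bij (bij_comp ev ub)) => x /=; rewrite uK.
have [n en] := fitting Uind ev_nb.
pose r := mk_linear (sum_linear (index_enum 'I_s) (fun l => e (lift ord0 l))).
have rE x : r x = u x - e ord0 x by rewrite /= uE big_ord_recl addrAC subrr add0r.
have rvb : bijective (r \o v : {linear U -> U}).
  by apply: nilpotent_one_sub Ufg en _ => x; rewrite [LHS]rE vK.
have rb : bijective r.
  by apply: (eq_bij (bij_comp rvb ub)) => x; apply: congr1 (uK x).
have [l lb] := IHs (fun l => e (lift ord0 l)) r rb (fun=> erefl).
by exists (lift ord0 l).
Qed.

Lemma ffun_sum_linear X (I : finType) T (f : I -> {linear T -> X}) :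
  linear (fun t : {ffun I -> T} => \sum_l f l (t l)).
Proof.
move=> a x y; rewrite scaler_sumr -big_split; apply: eq_bigr => l _.
by rewrite !ffunE linearP.
Qed.
Definition ffun_sum X (I : finType) T (f : I -> {linear T -> X}) :=
  mk_linear (ffun_sum_linear f).

Lemma ffun_pair_linear X (I : finType) T (f : I -> {linear X -> T}) :
  linear (fun x => [ffun l => f l x]).
Proof. by move=> a x y; apply/ffunP => l; rewrite !ffunE linearP. Qed.
Definition ffun_pair X (I : finType) T (f : I -> {linear X -> T}) :=
  mk_linear (ffun_pair_linear f).

Lemma ffun_proj_linear (I : finType) T (l : I) : linear (fun t : {ffun I -> T} => t l).
Proof. by move=> a x y; rewrite !ffunE. Qed.
Definition ffun_proj (I : finType) T (l : I) := mk_linear (@ffun_proj_linear I T l).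

Lemma ffun_in_linear (I : finType) T (l : I) :
  linear (fun t : T => [ffun j => if j == l then t else 0]).
Proof.
move=> a x y; apply/ffunP => j; rewrite !ffunE.
by case: eqP => _ //; rewrite scaler0 addr0.
Qed.
Definition ffun_in (I : finType) T (l : I) := mk_linear (@ffun_in_linear I T l).

Lemma ext_vanishes_ffun U X (I : finType) :
  ext_vanishes U X -> ext_vanishes U {ffun I -> X}.
Proof.
move=> ext0 d dc.
have dP l : exists h : U -> X, klinear h /\ forall a t, d a t l = bar_d0 h a t.
  by apply: ext0; apply: (cocycle_post (@ffun_proj I X l)).
have [h hP] := exists_choice dP.
exists (fun t => [ffun l => h l t]); split.
  by move=> c x y; apply/ffunP => l; rewrite !ffunE; apply: (hP l).1.
by move=> a t; apply/ffunP => l; rewrite (hP l).2 !ffunE.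
Qed.

Lemma scale_k_linear X (c : k) : linear (fun x : X => (c%:A : A) *: x).
Proof. by move=> a x y; rewrite scalerDr scaler_kA. Qed.
Definition scale_k X (c : k) := mk_linear (@scale_k_linear X c).

(** Consequently all maps T -> X satisfying Q factor through a single map from a
    power T^s to X, whose components satisfy Q themselves. *)
Lemma hom_span T X (Q : {linear T -> X} -> Prop) : fin_gen T -> fin_gen X ->
  exists s (f : 'I_s -> {linear T -> X}), (forall l, Q (f l)) /\
    forall g, Q g -> exists c : 'I_s -> k, forall t, g t = \sum_l (c l)%:A *: f l t.
Proof.
move=> Tfg Xfg.
pose P (h : Homk T X) := exists g, Q g /\ forall t, hval h t = g t.
have [s [v [vP vspan]]] := finite_spanning_family P (fin_dim_Homk Tfg Xfg).
have [f fP] := exists_choice vP.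
exists s, f; split=> [l|g Qg]; first exact: (fP l).1.
have [|c cE] := vspan (to_Homk (linear_klinear g)); first by exists g.
exists c => t; rewrite -[LHS]/(hval (to_Homk (linear_klinear g)) t) cE.
have hs : forall h h' : Homk T X, hval (h + h') t = hval h t + hval h' t by [].
rewrite (big_morph (fun h => hval h t) (hs) (hval0 X t)).
by apply: eq_bigr => l _; rewrite -(fP l).2.
Qed.

Variable T : lmodType A.
Hypotheses (Tfg : fin_gen T) (Tre : right_exact T) (TT : ext_vanishes T T).

(** Modules generated by T are torsion: Ext^1(T, T^s) = 0 and Ext^1(T, -) is right
    exact. *)
Lemma ext_vanishes_generated X (I : finType) (w : {linear {ffun I -> T} -> X}) :
  surjective w -> ext_vanishes T X.
Proof.
move=> ws; apply: (ext_vanishes_quo Tre _ ws); last exact: ext_vanishes_ffun.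
by apply: surjective_fin_gen ws _; apply: fin_gen_ffun.
Qed.

(** W is the trace of T in X, the sum of the images of all maps T -> X. It is
    generated by T, so Ext^1(T, W) = 0, maps from T to the quotient L lift to X, and
    they land in W: hence Hom(T, L) = 0. This is the torsion pair of T. *)
Lemma torsion_quotient X : fin_gen X ->
  exists W L (j : {linear W -> X}) (p : {linear X -> L})
    s (w : {linear {ffun 'I_s -> T} -> W}),
  [/\ short_exact j p, surjective w, ext_vanishes T W,
      forall f : {linear T -> X}, exists g : {linear T -> W}, forall t, j (g t) = f t &
      in_F T L].
Proof.
move=> Xfg; have [s [f [_ fspan]]] := @hom_span T X (fun=> True) Tfg Xfg.
have [W [w [j [ji ws jw]]]] := exists_image (ffun_sum f).
have [L [p [ps pP]]] := exists_cokernel j.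
have lft (g : {linear T -> X}) : exists h : {linear T -> W}, forall t, j (h t) = g t.
  have [c cE] := fspan g I.
  exists (w \o ffun_pair (fun l => scale_k T (c l))) => t /=.
  rewrite jw cE /=; apply: eq_bigr => l _.
  by rewrite ffunE /= linearZ.
have extW : ext_vanishes T W by apply: ext_vanishes_generated ws.
have ses : short_exact j p by [].
exists W, L, j, p, s, w; split=> // u t.
have Lfg := surjective_fin_gen ps Xfg.
have [v vE] := lift_of_ext_vanishes ses Lfg extW u.
have [h hE] := lft v.
by rewrite -vE; apply/pP; exists (h t).
Qed.

(** Exactness at Ext^1(U, X). *)
Lemma ext_vanishes_mid U X' X X'' (i : {linear X' -> X}) (p : {linear X -> X''}) :
  short_exact i p -> fin_gen X'' -> ext_vanishes U X' -> ext_vanishes U X'' ->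
  ext_vanishes U X.
Proof.
move=> [ii ps ex] X''fg ext' ext'' d dc.
have [h [hl hE]] := ext'' _ (cocycle_post p dc).
have [s [sl sP]] := klinear_section ps X''fg.
have shl := klinear_comp sl hl.
have eP a t : exists x, i x = d a t - bar_d0 (s \o h) a t.
  apply/ex; rewrite linearB hE bar_d0_post; apply/eqP; rewrite subr_eq0; apply/eqP.
  by rewrite /bar_d0 /= !sP.
have [e [ec eE]] := cocycle_lift_inj ii (cocycle_sub dc (bar_d0_cocycle shl)) eP.
have [h' [h'l h'E]] := ext' e ec.
have ih'l := klinear_comp (linear_klinear i) h'l.
exists (fun t => (s \o h) t + i (h' t)); split.
  move=> c x y; rewrite (shl c x y) -/((i \o h') (c%:A *: x + y)) (ih'l c x y).
  by rewrite scalerDr addrACA.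
move=> a t; have := eE a t; rewrite h'E bar_d0_post => /eqP; rewrite eq_sym subr_eq => /eqP->.
by rewrite /bar_d0 /= scalerDr opprD [RHS]addrACA [RHS]addrC.
Qed.

End Orthogonality.

(** * Modules orthogonal to a tilting module vanish *)

Section TestModules.
Variables (k : fieldType) (A : falgType k).
Implicit Types (X Y Z U L T W R K S V : lmodType A).

(** Direct summands in the form in which they are used. *)
Definition retract_of X U := exists (i : {linear U -> X}) (r : {linear X -> U}),
  forall u, r (i u) = u.

Lemma summand_retract X U : summand U X -> retract_of X U.
Proof.
move=> [Y [f /linear_bij_inv[g fK gK]]].
have ilin : linear (fun x : U => g (x, 0 : Y)).
  by move=> a x y; rewrite -linearP; congr (g _); congr pair; rewrite /= ?scaler0 ?addr0.
have rlin : linear (fun x => (f x).1) by move=> a x y; rewrite linearP.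
by exists (mk_linear ilin), (mk_linear rlin) => u; rewrite /= gK.
Qed.

Variable T : lmodType A.
Hypotheses (Tfg : fin_gen T) (Tre : right_exact T) (TT : ext_vanishes T T).

(** The module L is dual to the summand V of T for the Euler form.

    Let phi : R -> V, with R a power of T, be assembled from maps T -> V that span all
    those that are not split epimorphisms. A map U -> V from a summand not isomorphic
    to V extends to a map T -> V that is not a split epimorphism, so it factors through
    phi; the identity of V does not factor through phi because End(V) is local.

    If phi is not surjective, let L be its cokernel. Both L and the image of phi are
    generated by T, so Ext^1(T, L) = 0 and every map U -> L lifts to V; thus Hom(U, L)
    vanishes for the other summands, whereas V -> L is not zero. If phi is surjective
    with kernel K, then Ext^1(U, K) is the obstruction to factoring maps U -> V through
    phi, so it vanishes for the other summands but not for V. Dividing K by the trace of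
    T leaves these groups unchanged and makes Hom(T, -) vanish. In the terms of
    B = End(T), the module L is S (x) T or Tor_1(S, T), where S is the simple B-module
    corresponding to V. *)
Lemma exists_test_module V : indecomposable V -> retract_of T V ->
  exists L, [/\ fin_gen L, euler V L != 0 &
    forall U, indecomposable U -> retract_of T U -> ~ isomorphic U V -> euler U L = 0].
Proof.
move=> Vind [iV [rV rVi]]; have [Vfg V0 _] := Vind.
have [s [f [fns fspan]]] := @hom_span _ _ T V (fun f => ~ split_epi f) Tfg Vfg.
pose phi := ffun_sum f.
have Rfg : fin_gen {ffun 'I_s -> T} by apply: fin_gen_ffun.
have phi_lift U (u : {linear U -> V}) : indecomposable U -> retract_of T U ->
    ~ isomorphic U V -> exists v : {linear U -> {ffun 'I_s -> T}}, forall x, phi (v x) = u x.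
  move=> Uind [iU [rU rUi]] nUV.
  have [|c cE] := fspan (u \o rU).
    move=> [g gE]; apply: nUV; exists u; exists (rU \o g); last exact: gE.
    exact: (@retract_of_indecomposable _ V U (rU \o g : {linear V -> U}) u Uind V0 gE).
  exists (ffun_pair (fun l => scale_k T (c l) \o iU)) => x.
  rewrite -[in RHS](rUi x) -[RHS]/((u \o rU) (iU x)) cE /=.
  by apply: eq_bigr => l _; rewrite ffunE /= linearZ.
have phi_nsplit (v : {linear V -> {ffun 'I_s -> T}}) : ~ forall x, phi (v x) = x.
  move=> vE.
  have [||l [g gE1 gE2]] := @bijective_summand k A V s
    (fun l => f l \o (ffun_proj T l \o v)) idfun Vind.
  - by exists id.
  - by move=> x; rewrite -[LHS]vE.
  have gb : bijective g by exists (f l \o (ffun_proj T l \o v)).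
  have [g' g'E] : exists g' : {linear V -> V}, forall x, f l (v (g' x) l) = x.
    have [|g' g'K g'K'] := @linear_bij_inv _ _ _ (f l \o (ffun_proj T l \o v) : {linear V -> V}).
      by exists g.
    by exists g'.
  by apply: (fns l); exists (ffun_proj T l \o (v \o g')).
have [W [q [j [ji qs jq]]]] := exists_image phi.
have extW : ext_vanishes T W by apply: (ext_vanishes_generated Tfg Tre TT qs).
have ext_r U X : retract_of T U -> ext_vanishes T X -> ext_vanishes U X.
  by move=> [iU [rU rUi]] extX; exact: ext_vanishes_retract rUi _ extX.
have [js|njs] := pselect (surjective j); last first.
  have [C [p [ps pP]]] := exists_cokernel j.
  have Cfg := surjective_fin_gen ps Vfg.
  have extC : ext_vanishes T C.
    apply: (ext_vanishes_quo Tre Cfg ps).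
    by apply: (ext_vanishes_quo Tre Vfg _ TT) => x; exists (iV x); apply: rVi.
  exists C; split=> //.
    apply: euler_hom_neq0 => //; first by apply: ext_r extC; exists iV, rV.
    exists p; apply: contrapT => np; apply: njs => x; apply/pP.
    by apply: contrapT => px; apply: np; exists x.
  move=> U Uind UT nUV; have [Ufg _ _] := Uind.
  apply: euler_eq0 => //; last exact: ext_r extC.
  move=> u x; have sesC : short_exact j p by [].
  have [v vE] := lift_of_ext_vanishes sesC Cfg (ext_r U W UT extW) u.
  have [v' v'E] := phi_lift U v Uind UT nUV.
  by rewrite -vE; apply/pP; exists (q (v' x)); rewrite jq.
have phis : surjective phi.
  by move=> x; have [w <-] := js x; have [y <-] := qs w; exists y; rewrite -jq.
have [K [i [ii iP]]] := exists_kernel phi.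
have Kfg := fin_gen_sub ii Rfg.
have sesK : short_exact i phi by [].
have extR U : retract_of T U -> ext_vanishes U {ffun 'I_s -> T}.
  by move=> UT; apply: ext_r => //; apply: ext_vanishes_ffun.
have [W' [L [jj [pp [s' [w [sesL ws extW' lft homL]]]]]]] :=
  torsion_quotient Tfg Tre TT Kfg.
have [_ pps _] := sesL.
have Lfg := surjective_fin_gen pps Kfg.
(* Hom(T, L) = 0 restricts to every summand U of T. *)
have homUL U : retract_of T U -> forall u : {linear U -> L}, forall x, u x = 0.
  move=> [iU [rU rUi]] u x; rewrite -(rUi x).
  exact: (homL (u \o rU)).
exists L; split=> //.
  have VT : retract_of T V by exists iV, rV.
  apply: euler_ext_neq0 => //; last exact: homUL.
  move=> extL; have extK : ext_vanishes V K.
    by apply: (ext_vanishes_mid sesL Lfg) => //; apply: ext_r extW'.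
  have [v vE] := lift_of_ext_vanishes sesK Vfg extK idfun.
  exact: phi_nsplit vE.
move=> U Uind UT nUV; have [Ufg _ _] := Uind.
apply: euler_eq0 => //; first exact: homUL.
have Ure : right_exact U by case: UT => iU [rU rUi]; apply: right_exact_retract rUi Tre.
apply: (ext_vanishes_quo Ure Lfg pps).
exact: ext_vanishes_sub sesK (fun u => phi_lift U u Uind UT nUV) (extR U UT).
Qed.

(** The m i are the multiplicities of the simple modules in a composition series of
    L, recorded through the additivity of the Euler form along it. *)
Lemma simple_multiplicities n (S : 'I_n -> lmodType A) L :
  (forall M, simple_module M -> exists i, isomorphic M (S i)) -> fin_gen L ->
  exists m : 'I_n -> nat, (~ is_zero L -> exists i, m i != 0%N) /\
    forall U, fin_gen U -> right_exact U ->
      euler U L = \sum_i (m i)%:R * euler U (S i).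
Proof.
move=> SP; have [d] := ubnP (adim L); elim: d L => // d IHd L; rewrite ltnS => Ld Lfg.
have [L0|L0] := pselect (is_zero L).
  exists (fun=> 0%N); split=> // U Ufg Ure.
  by rewrite euler_zero // big1 // => i _; rewrite mul0r.
have [S' [i [ii S's]]] := exists_simple_submodule Lfg L0.
have [p0 isoS] := SP _ S's.
have [L' [p [ps pP]]] := exists_cokernel i.
have ses : short_exact i p by [].
have L'fg := surjective_fin_gen ps Lfg.
have S'fg := fin_gen_sub ii Lfg.
have [|m [_ mE]] := IHd L' _ L'fg.
  apply: leq_trans Ld; rewrite (adim_exact ses Lfg) -[X in (X < _)%N]add0n ltn_add2r.
  by rewrite lt0n; apply/eqP => /(adim_eq0 S'fg); case: S's.
exists (fun j => (m j + (j == p0))%N); split=> [_|U Ufg Ure].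
  by exists p0; rewrite eqxx addn1.
rewrite (euler_exact Ufg Ure ses Lfg) (euler_iso Ufg Ure S'fg isoS) mE //.
under [RHS]eq_bigr do rewrite natrD mulrDl.
rewrite big_split addrC /=; congr (_ + _).
rewrite (bigD1 p0) //= eqxx mul1r big1 ?addr0 // => j jp.
by rewrite (negPf jp) mul0r.
Qed.

Lemma in_T_ext_vanishes X Y : is_zero (Ext1 X Y) <-> ext_vanishes X Y.
Proof.
split=> [E0 d dc|ext0 q].
  have dc' : d \in cocycle X Y by apply/is_cocycleP.
  have := E0 (quot_proj (coboundary X Y) (exist _ d dc')).
  have -> : 0 = quot_proj (coboundary X Y) 0 :> Ext1 X Y.
    by rewrite -[0 in RHS](scale0r (0 : Z1 X Y)) quot_projZ scale0r.
  move=> /quot_projP; rewrite subr0 => /coboundaryP[h [hl hE]].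
  by exists h; split=> // a t; rewrite -hE.
rewrite -(quot_projK q); move: (repr q) => d.
have -> : 0 = quot_proj (coboundary X Y) 0 :> Ext1 X Y.
  by rewrite -[0 in RHS](scale0r (0 : Z1 X Y)) quot_projZ scale0r.
apply/quot_projP; rewrite subr0; apply/coboundaryP.
have [h [hl hE]] := ext0 _ ((is_cocycleP _).1 (valP d)).
by exists h; split=> //; apply/funext=> a; apply/funext=> t; apply: hE.
Qed.

End TestModules.

(** Let T_1, ..., T_n be the indecomposable summands of T, S_1, ..., S_n the simple
    modules, and L_j the module dual to T_j. By additivity the matrix of the values
    euler T_i L_j, which is diagonal with nonzero diagonal entries, is the product of the
    n x n matrix of multiplicities of the S_s in the L_j and the n x n matrix E of the
    values euler T_i S_s. So E is invertible. The multiplicities of the simple modules in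
    K form a row vector killed by E, hence they vanish, and so does K. *)
Lemma tilting_orthogonal (k : fieldType) (A : falgType k) (T K : lmodType A) :
  tilting T -> fin_gen K -> in_F T K -> ext_vanishes T K -> is_zero K.
Proof.
move=> [Tfg Tpd /in_T_ext_vanishes TT [n [[Ti [TiP Ti_inj _]] [Si [_ _ SiP]]]]] Kfg homK extK.
have Tre := pd_le1_right_exact Tfg Tpd.
have Tir i : retract_of T (Ti i) by apply: summand_retract; case: (TiP i).
have Tifg i : fin_gen (Ti i) by case: (TiP i) => -[].
have Tire i : right_exact (Ti i).
  by have [iU [rU rUi]] := Tir i; apply: right_exact_retract rUi Tre.
have /exists_choice[L LP] j := exists_test_module Tfg Tre TT (TiP j).1 (Tir j).
have mult X : fin_gen X -> exists m : 'I_n -> nat, (~ is_zero X -> exists i, m i != 0%N) /\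
    forall i, euler (Ti i) X = \sum_j (m j)%:R * euler (Ti i) (Si j).
  move=> Xfg; have [m [m0 mE]] := simple_multiplicities SiP Xfg.
  by exists m; split=> // i; apply: mE.
have /exists_choice[m mP] j := mult (L j) (let: And3 H _ _ := LP j in H).
have [mK [mK0 mKE]] := mult K Kfg.
pose M := \matrix_(j, s) (m j s)%:R : 'M[rat]_n.
pose E := \matrix_(s, i) euler (Ti i) (Si s) : 'M[rat]_n.
have MEE : M *m E = diag_mx (\row_j euler (Ti j) (L j)).
  apply/matrixP => j i; rewrite !mxE.
  under eq_bigr do rewrite !mxE.
  rewrite -(mP j).2; case: eqP => [->|/eqP ij]; first by rewrite mulr1n.
  rewrite mulr0n; have [_ _ -> //] := LP j; first by case: (TiP i).
  by move/Ti_inj=> ji; rewrite ji eqxx in ij.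
have Eunit : E \in unitmx.
  have : M *m E \in unitmx.
    rewrite MEE unitmxE det_diag unitfE; apply/prodf_neq0 => j _.
    by rewrite mxE; case: (LP j).
  by rewrite unitmx_mul => /andP[].
apply: contrapT => /mK0[s ms].
pose mu := \row_s (mK s)%:R : 'rV[rat]_n.
have muE : mu *m E = 0.
  apply/rowP => i; rewrite !mxE; under eq_bigr do rewrite !mxE.
  rewrite -mKE euler_eq0 //.
    have [iU [rU rUi]] := Tir i => u x; rewrite -(rUi x).
    exact: (homK (u \o rU)).
  by have [iU [rU rUi]] := Tir i; exact: ext_vanishes_retract rUi _ extK.
have : mu = 0 by rewrite -(mulmxK Eunit mu) muE mul0mx.
move=> /rowP/(_ s); rewrite !mxE => /eqP.
by rewrite Num.Theory.pnatr_eq0 (negPf ms).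
Qed.

(** * Extension classes over the endomorphism ring *)

Section Classes.
Variables (k : fieldType) (A : falgType k).
Implicit Types (X Y Z U L T E : lmodType A).

Definition ext_class T X (d : A -> T -> X) (dc : is_cocycle d) : Ext1 T X :=
  quot_proj (coboundary T X) (exist _ d ((is_cocycleP d).2 dc) : Z1 T X).

Lemma ext_class_eq T X (d e : A -> T -> X) (dc : is_cocycle d) (ec : is_cocycle e) :
  ext_class dc = ext_class ec <->
  exists h : T -> X, klinear h /\ forall a t, d a t - e a t = bar_d0 h a t.
Proof.
split=> [/quot_projP/coboundaryP[h [hl hE]]|[h [hl hE]]].
  by exists h; split=> // a t; rewrite -hE.
apply/quot_projP/coboundaryP; exists h; split=> //.
by apply/funext=> a; apply/funext=> t; apply: hE.
Qed.

Lemma cocycle0 T X : is_cocycle (fun _ _ => 0 : X) (U := T).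
Proof.
split; first split.
- by move=> a c x y; rewrite scaler0 addr0.
- by move=> c a b t; rewrite scaler0 addr0.
- by move=> a b t; rewrite scaler0 addr0.
Qed.

Lemma ext_class0 T X : ext_class (cocycle0 T X) = 0.
Proof.
rewrite -[RHS](scale0r (ext_class (cocycle0 T X))) -[RHS]quot_projZ.
congr quot_proj; exact: val_inj.
Qed.

Lemma ext_class_eq0 T X (d : A -> T -> X) (dc : is_cocycle d) :
  ext_class dc = 0 <-> exists h : T -> X, klinear h /\ forall a t, d a t = bar_d0 h a t.
Proof.
rewrite -ext_class0 ext_class_eq.
by split=> -[h [hl hE]]; exists h; split=> // a t; rewrite -hE subr0.
Qed.

Lemma ext_class_surj T X (q : Ext1 T X) : exists d (dc : is_cocycle d), q = ext_class dc.
Proof.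
rewrite -(quot_projK q); case: (repr q) => d dP.
exists d, ((is_cocycleP d).1 dP); congr quot_proj; exact: val_inj.
Qed.

Lemma Ext1_map_class T X Y (f : {linear X -> Y}) (d : A -> T -> X) (dc : is_cocycle d) :
  Ext1_map T f (ext_class dc) = ext_class (cocycle_post f dc).
Proof. by rewrite Ext1_mapE; congr quot_proj; apply: val_inj. Qed.

Lemma ext_class_scale T X (b : End_op T) (d : A -> T -> X) (dc : is_cocycle d) :
  b *: ext_class dc = ext_class (cocycle_pre (b : {linear T -> T}) dc).
Proof. by rewrite -[LHS]quot_projZ; congr quot_proj; apply: val_inj. Qed.

Lemma cocycle_add T X (d e : A -> T -> X) :
  is_cocycle d -> is_cocycle e -> is_cocycle (fun a t => d a t + e a t).
Proof.
move=> [[dl dr] d0] [[el er] e0]; split; first split.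
- by move=> a c x y; rewrite dl el scalerDr addrACA.
- by move=> c a a' t; rewrite dr er scalerDr addrACA.
- by move=> a a' t; rewrite d0 e0 scalerDr addrACA.
Qed.

Lemma ext_classD T X (d e : A -> T -> X) (dc : is_cocycle d) (ec : is_cocycle e) :
  ext_class dc + ext_class ec = ext_class (cocycle_add dc ec).
Proof. by rewrite -[LHS]quot_projD; congr quot_proj; apply: val_inj. Qed.

Lemma cocycle_sum T X n (d : 'I_n -> A -> T -> X) :
  (forall l, is_cocycle (d l)) -> is_cocycle (fun a t => \sum_l d l a t).
Proof.
move=> dc; split; first split.
- move=> a c x y; rewrite scaler_sumr -big_split; apply: eq_bigr => l _.
  by have [[dl _] _] := dc l; rewrite dl.
- move=> c a b t; rewrite scaler_sumr -big_split; apply: eq_bigr => l _.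
  by have [[_ dr] _] := dc l; rewrite dr.
- move=> a b t; rewrite scaler_sumr -big_split; apply: eq_bigr => l _.
  by have [_ d0] := dc l; rewrite d0.
Qed.

Lemma ext_class_irr T X (d e : A -> T -> X) (dc : is_cocycle d) (ec : is_cocycle e) :
  (forall a t, d a t = e a t) -> ext_class dc = ext_class ec.
Proof.
move=> de; apply/ext_class_eq; exists (fun=> 0); split.
  by move=> c x y; rewrite scaler0 addr0.
by move=> a t; rewrite de subrr /bar_d0 scaler0 subrr.
Qed.

Lemma ext_class_sum T X n (d : 'I_n -> A -> T -> X) (dc : forall l, is_cocycle (d l)) :
  \sum_l ext_class (dc l) = ext_class (cocycle_sum dc).
Proof.
elim: n d dc => [|n IHn] d dc.
  rewrite big_ord0 -ext_class0; apply: ext_class_irr => a t; by rewrite big_ord0.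
rewrite big_ord_recl (IHn (fun l => d (lift ord0 l)) (fun l => dc (lift ord0 l))) ext_classD.
by apply: ext_class_irr => a t; rewrite big_ord_recl.
Qed.

(** The cocycle on T^n with components d_l. *)
Definition ffun_cocycle T X n (d : 'I_n -> A -> T -> X) : A -> {ffun 'I_n -> T} -> X :=
  fun a u => \sum_l d l a (u l).

Lemma ffun_cocycleP T X n (d : 'I_n -> A -> T -> X) :
  (forall l, is_cocycle (d l)) -> is_cocycle (ffun_cocycle d).
Proof. by move=> dc; apply: cocycle_sum => l; apply: (cocycle_pre (ffun_proj T l)). Qed.

Lemma cocycle_r0 T X (d : A -> T -> X) a : is_cocycle d -> d a 0 = 0.
Proof. by move=> [[dl _] _]; apply: klinear0. Qed.

Lemma ffun_cocycle_in T X n (d : 'I_n -> A -> T -> X) a l t :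
  (forall l, is_cocycle (d l)) -> ffun_cocycle d a (ffun_in T l t) = d l a t.
Proof.
move=> dc; rewrite /ffun_cocycle (bigD1 l) //= ffunE eqxx big1 ?addr0 // => j jl.
by rewrite ffunE (negPf jl) cocycle_r0.
Qed.

(** B = End(T) acts on Ext^1(T, X) by pullback: restricting the class on T^n along
    b = (b_l) gives the combination of the classes of the d_l with coefficients b_l. *)
Lemma ext_class_comb T X n (d : 'I_n -> A -> T -> X) (dc : forall l, is_cocycle (d l))
    (b : {linear T -> {ffun 'I_n -> T}}) :
  ext_class (cocycle_pre b (ffun_cocycleP dc)) =
  \sum_l (ffun_proj T l \o b : End_op T) *: ext_class (dc l).
Proof.
rewrite -[RHS]/(\sum_l ((ffun_proj T l \o b : {linear T -> T}) : End_op T) *: ext_class (dc l)).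
under eq_bigr do rewrite ext_class_scale.
by rewrite ext_class_sum; apply: ext_class_irr.
Qed.

(** Ext^1(T, X) is finitely generated over B, already through scalars in k: finitely
    many cocycles span all of them over k, and c in k acts as the endomorphism c of T. *)
Lemma cocycle_span T X : fin_gen T -> fin_gen X ->
  exists n (d : 'I_n -> A -> T -> X), (forall l, is_cocycle (d l)) /\
    forall e, is_cocycle e -> exists b : {linear T -> {ffun 'I_n -> T}},
      forall a t, e a t = ffun_cocycle d a (b t).
Proof.
move=> Tfg Xfg.
have [n [v [_ vspan]]] := finite_spanning_family (fun=> True) (fin_dim_Zk Tfg Xfg).
exists n, (fun l => zval (v l)); split=> [l|e ec]; first exact: zval_cocycle.
have [c cE] := vspan (to_Zk ec) I.
exists (ffun_pair (fun l => scale_k T (c l))) => a t.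
rewrite -[LHS]/(zval (to_Zk ec) a t) cE.
have zs : forall d d' : Zk T X, zval (d + d') a t = zval d a t + zval d' a t by [].
rewrite (big_morph (fun d => zval d a t) zs (zval0 X a t)).
apply: eq_bigr => l _; rewrite /= ffunE /=.
have [[dl _] _] := zval_cocycle (v l).
by rewrite (klinearZ _ _ (dl a)).
Qed.

End Classes.

(** * The universal extension *)

Section Extensions.
Variables (k : fieldType) (A : falgType k).
Implicit Types (X Y Z U L T E : lmodType A).

(** An extension of U by Z together with a k-linear section s whose defect of
    A-linearity is D. *)
Definition extension Z U (D : A -> U -> Z) E (i : {linear Z -> E}) (p : {linear E -> U})
    (s : U -> E) :=
  [/\ short_exact i p, klinear s, forall u, p (s u) = u &
      forall a u, bar_d0 s a u = i (D a u)].

Section ExtensionData.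
Variables (Z U : lmodType A) (D : A -> U -> Z).
Variables (E : lmodType A) (i : {linear Z -> E}) (p : {linear E -> U}) (s : U -> E).
Hypothesis HE : extension D i p s.

Lemma extension_part e : exists z, i z = e - s (p e).
Proof. by have [[_ _ ex] sl sP _] := HE; apply/ex; rewrite linearB sP subrr. Qed.

Lemma extension_fin_gen : fin_gen Z -> fin_gen U -> fin_gen E.
Proof.
have [[ii ps ex] sl sP sD] := HE; rewrite !fin_gen_fin_dim => Zfd Ufd.
have hl : linear (fun x : kmod Z * kmod U => i x.1 + s x.2 : kmod E).
  move=> c x y.
  have := linear_klinear i c x.1 y.1; have := sl c x.2 y.2.
  rewrite -/(x.1 : Z) => e1 e2.
  by rewrite [X in X + _ = _]e2 [X in _ + X = _]e1 scalerDr addrACA.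
apply: (fin_dim_quo (p := mk_linear hl)); last exact: fin_dim_prod.
by move=> e; have [z zE] := extension_part e; exists (z, p e); rewrite /= zE subrK.
Qed.

(** The composite of Hom(T, E) -> Hom(T, U) with the connecting map to Ext^1(T, Z)
    is zero; the section s gives the explicit primitive s p g - g. *)
Lemma connecting_zero T (g : {linear T -> E}) :
  exists h : T -> Z, klinear h /\ forall a t, D a (p (g t)) = bar_d0 h a t.
Proof.
have [[ii ps ex] sl sP sD] := HE.
have hP t : exists z, i z = s (p (g t)) - g t.
  by apply/ex; rewrite linearB sP subrr.
have [h hE] := exists_choice hP; exists h; split.
  apply: klinear_reflect ii _; rewrite (_ : (fun _ => _) = fun t => s (p (g t)) - g t).
    apply: klinear_sub; last exact: linear_klinear.
    exact: (klinear_comp (klinear_comp sl (linear_klinear p)) (linear_klinear g)).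
  exact/funext.
move=> a t; apply: ii; rewrite -sD bar_d0_post.
have -> : (fun t => i (h t)) = (fun t => s (p (g t)) - g t) by apply/funext.
by rewrite bar_d0B bar_d0_linear subr0 /bar_d0 !linearZ.
Qed.

(** Conversely, a map to U with zero image under the connecting map lifts to E: the
    primitive h corrects s b into an A-linear map. *)
Lemma lift_of_coboundary T (b : {linear T -> U}) (h : T -> Z) : klinear h ->
  (forall a t, D a (b t) = bar_d0 h a t) ->
  exists g : {linear T -> E}, forall t, p (g t) = b t.
Proof.
have [[ii ps ex] sl sP sD] := HE; move=> hl hE.
have ihl := klinear_comp (linear_klinear i) hl.
have [g gE] : exists g : {linear T -> E}, forall t, g t = s (b t) - i (h t).
  apply: linear_of_bar_d0.
    apply: klinear_sub ihl; exact: klinear_comp sl (linear_klinear b).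
  move=> a t; rewrite bar_d0B -[X in _ - X]bar_d0_post -hE -sD /bar_d0 linearZ.
  by rewrite subrr.
exists g => t; rewrite gE linearB sP.
by have -> : p (i (h t)) = 0 by [apply/ex; exists (h t)]; rewrite subr0.
Qed.

(** A map f on Z extends to E when it sends the class of the extension to zero. *)
Lemma extension_map_out X (f : {linear Z -> X}) (h : U -> X) : klinear h ->
  (forall a u, bar_d0 h a u = f (D a u)) ->
  exists g : {linear E -> X}, forall z, g (i z) = f z.
Proof.
have [[ii ps ex] sl sP sD] := HE; move=> hl hE.
have [z zE] := exists_choice extension_part.
have glin : linear (fun e => f (z e) + h (p e)).
  move=> a e e'.
  have -> : z (a *: e + e') = a *: z e + D a (p e) + z e'.
    apply: ii; rewrite zE !linearD !linearZ -sD /bar_d0 !zE (klinearD sl) /= scalerBr.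
    by rewrite opprD addrACA; congr (_ + _); rewrite addrA subrK.
  rewrite !linearD !linearZ /= (klinearD hl) -hE /bar_d0 scalerDr.
  by rewrite addrACA; congr (_ + _); rewrite -addrA subrK.
exists (mk_linear glin) => x /=.
have pi0 : p (i x) = 0 by apply/ex; exists x.
rewrite pi0 (klinear0 hl) addr0; congr (f _); apply: ii.
by rewrite zE pi0 (klinear0 sl) subr0.
Qed.

End ExtensionData.

(** The extension 0 -> Z -> E -> T^n -> 0 whose components generate Ext^1(T, Z) over
    B. The connecting map Hom(T, T^n) -> Ext^1(T, Z) is then surjective, and
    Ext^1(T, T^n) = 0, so that Ext^1(T, E) = 0. *)
Lemma universal_extension T Z : fin_gen T -> fin_gen Z -> ext_vanishes T T ->
  exists n (d : 'I_n -> A -> T -> Z) (E : lmodType A) (i : {linear Z -> E})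
    (p : {linear E -> {ffun 'I_n -> T}}) s,
  [/\ forall l, is_cocycle (d l),
      forall e, is_cocycle e -> exists b : {linear T -> {ffun 'I_n -> T}},
        forall a t, e a t = ffun_cocycle d a (b t),
      extension (ffun_cocycle d) i p s, ext_vanishes T E & fin_gen E].
Proof.
move=> Tfg Zfg TT; have [n [d [dc dspan]]] := cocycle_span Tfg Zfg.
have [E [i [p [s HE]]]] := exists_extension (ffun_cocycleP dc).
exists n, d, E, i, p, s; split=> //; last first.
  by apply: extension_fin_gen HE Zfg _; apply: fin_gen_ffun.
have [[ii ps ex] sl sP sD] := HE.
move=> e ec; have [h [hl hE]] := ext_vanishes_ffun TT (cocycle_post p ec).
have shl := klinear_comp sl hl.
have e'P a t : exists z, i z = e a t - bar_d0 (s \o h) a t.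
  apply/ex; rewrite linearB hE bar_d0_post /bar_d0 /= !sP; exact: subrr.
have [e' [e'c e'E]] := cocycle_lift_inj ii (cocycle_sub ec (bar_d0_cocycle shl)) e'P.
have [b bE] := dspan e' e'c.
exists (fun t => s (h t) + s (b t)); split.
  by move=> c x y; rewrite hl linearP !sl scalerDr addrACA.
move=> a t; have := e'E a t; rewrite bE -sD => /eqP; rewrite eq_sym subr_eq => /eqP->.
by rewrite /bar_d0 /= linearZ scalerDr opprD [RHS]addrACA [RHS]addrC.
Qed.

End Extensions.

(** * Ext^1(T, -) on the torsion-free modules *)

Section BrennerButler.
Variables (k : fieldType) (A : falgType k) (T : lmodType A).
Implicit Types (X Y Z U L E : lmodType A).
Hypothesis T_tilting : tilting T.

Lemma tilting_fin_gen : fin_gen T. Proof. by case: T_tilting. Qed.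
Lemma tilting_right_exact : right_exact T.
Proof. by case: T_tilting => Tfg Tpd _ _; apply: pd_le1_right_exact. Qed.
Lemma tilting_rigid : ext_vanishes T T.
Proof. by case: T_tilting => _ _ /in_T_ext_vanishes. Qed.
Let Tfg := tilting_fin_gen.
Let Tre := tilting_right_exact.
Let TT := tilting_rigid.

(** The quotient of X by the trace of T is orthogonal to T on both sides, hence
    zero. *)
Lemma tilting_generated X : fin_gen X -> ext_vanishes T X ->
  exists s (w : {linear {ffun 'I_s -> T} -> X}), surjective w.
Proof.
move=> Xfg extX.
have [W [L [j [p [s [w [ses ws _ _ homL]]]]]]] := torsion_quotient Tfg Tre TT Xfg.
have [ji ps ex] := ses; have Lfg := surjective_fin_gen ps Xfg.
have L0 := tilting_orthogonal T_tilting Lfg homL (ext_vanishes_quo Tre Lfg ps extX).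
exists s, (j \o w) => x; have [y <-] : exists y, j y = x by apply/ex; apply: L0.
by have [t <-] := ws y; exists t.
Qed.

Lemma ffun_in_sum (R : pzRingType) (V : lmodType R) (I : finType) (t : {ffun I -> V}) :
  t = \sum_l [ffun j => if j == l then t l else 0].
Proof.
apply/ffunP => j; rewrite sum_ffunE (bigD1 j) //= ffunE eqxx big1 ?addr0 // => l lj.
by rewrite ffunE eq_sym (negPf lj).
Qed.

Lemma hom_generated_torsionfree X Z n (w : {linear {ffun 'I_n -> T} -> X})
    (f : {linear X -> Z}) : surjective w -> in_F T Z -> forall x, f x = 0.
Proof.
move=> ws homZ x; have [t <-] := ws x.
rewrite (ffun_in_sum t) !linear_sum big1 // => l _.
exact: (homZ (f \o (w \o ffun_in T l)) (t l)).
Qed.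

(** If f kills Ext^1(T, Z), it extends to the universal extension E of Z. As E is
    generated by T and Hom(T, Z') = 0, the extension of f is zero. *)
Lemma Ext1_faithful Z Z' (f : {linear Z -> Z'}) : fin_gen Z -> in_F T Z' ->
  (forall q, Ext1_map T f q = 0) -> forall z, f z = 0.
Proof.
move=> Zfg homZ' f0.
have [n [d [E [i [p [s [dc dspan HE extE Efg]]]]]]] := universal_extension Tfg Zfg TT.
have hP l : exists h : T -> Z', klinear h /\ forall a t, f (d l a t) = bar_d0 h a t.
  by apply/(ext_class_eq0 (cocycle_post f (dc l))); rewrite -Ext1_map_class f0.
have [h hE] := exists_choice hP.
have [||g gE] := extension_map_out HE (f := f) (h := fun u => \sum_l h l (u l)).
- move=> c x y; rewrite scaler_sumr -big_split; apply: eq_bigr => l _.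
  by rewrite !ffunE; apply: (hE l).1.
- move=> a u; rewrite /bar_d0 scaler_sumr -sumrB linear_sum; apply: eq_bigr => l _.
  by rewrite (hE l).2 /bar_d0 ffunE.
have [m [w ws]] := tilting_generated Efg extE.
by move=> z; rewrite -gE; apply: hom_generated_torsionfree ws homZ' _.
Qed.

Lemma cocycle_span_class Z n (d : 'I_n -> A -> T -> Z) (dc : forall l, is_cocycle (d l)) :
  (forall e, is_cocycle e -> exists b : {linear T -> {ffun 'I_n -> T}},
     forall a t, e a t = ffun_cocycle d a (b t)) ->
  forall q : Ext1 T Z, exists b : 'I_n -> End_op T, q = \sum_l b l *: ext_class (dc l).
Proof.
move=> dspan q; have [e [ec ->]] := ext_class_surj q.
have [b bE] := dspan e ec; exists (fun l => ffun_proj T l \o b).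
by rewrite -ext_class_comb; apply: ext_class_irr.
Qed.

Lemma fin_gen_Ext1 Z : fin_gen Z -> fin_gen (Ext1 T Z).
Proof.
move=> Zfg; have [n [d [dc dspan]]] := cocycle_span Tfg Zfg.
exists n, (fun l => ext_class (dc l)) => q.
exact: cocycle_span_class dspan q.
Qed.

(** Let xi_l be generators of Ext^1(T, Z) and E the universal extension. A balanced
    map beta defines an additive map on T^n, sending (u_l) to the sum of the
    beta(xi_l, u_l). It vanishes on the image of every T -> E -> T^n, since the connecting
    map does. These images generate T^n, because E is generated by T and maps onto T^n. *)
Lemma Ext1_in_X Z : fin_gen Z -> in_X (Ext1 T Z).
Proof.
move=> Zfg; have [n [d [E [i [p [s [dc dspan HE extE Efg]]]]]]] := universal_extension Tfg Zfg TT.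
have [[ii ps ex] sl sP sD] := HE.
have [m [w ws]] := tilting_generated Efg extE.
have beta0 (W : zmodType) (beta : Ext1 T Z -> T -> W) : balanced beta ->
    forall q t, beta q t = 0.
  move=> [bDl bDr bB].
  have b0t t : beta 0 t = 0 by have := bDl 0 0 t; rewrite addr0 -[LHS]addr0 => /addrI.
  have bq0 q : beta q 0 = 0 by have := bDr q 0 0; rewrite addr0 -[LHS]addr0 => /addrI.
  have bsum (I : finType) (q : I -> Ext1 T Z) t : beta (\sum_l q l) t = \sum_l beta (q l) t.
    exact: (big_morph (fun q => beta q t) (fun q q' => bDl q q' t) (b0t t)).
  pose gamma (u : {ffun 'I_n -> T}) := \sum_l beta (ext_class (dc l)) (u l).
  have gD : {morph gamma : u v / u + v}.
    by move=> u v; rewrite -big_split; apply: eq_bigr => l _; rewrite ffunE bDr.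
  have g0 : gamma 0 = 0 by rewrite /gamma big1 // => l _; rewrite ffunE bq0.
  have gp (g : {linear T -> E}) t : gamma (p (g t)) = 0.
    have [h [hl hE]] := connecting_zero HE g.
    have : ext_class (cocycle_pre (p \o g : {linear T -> _}) (ffun_cocycleP dc)) = 0.
      by apply/ext_class_eq0; exists h.
    rewrite ext_class_comb => /(congr1 (fun q => beta q t)); rewrite b0t bsum => <-.
    by apply: eq_bigr => l _; rewrite bB.
  (* T^n is covered by E, and E by copies of T. *)
  have gamma0 u : gamma u = 0.
    have [e <-] := ps u; have [t <-] := ws e.
    rewrite (ffun_in_sum t) !linear_sum (big_morph gamma gD g0) big1 // => l _.
    exact: (gp (w \o ffun_in T l) (t l)).
  move=> q t; have [b ->] := cocycle_span_class dc dspan q.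
  rewrite bsum big1 // => l _; rewrite bB.
  rewrite -[RHS](gamma0 (ffun_in T l ((b l : {linear T -> T}) t))) /gamma.
  rewrite (bigD1 l) //= ffunE eqxx big1 ?addr0 // => j jl.
  by rewrite ffunE (negPf jl) bq0.
(* All balanced maps vanish, so the zero group is a tensor product. *)
pose P : zmodType := 'rV[rat]_0.
have P0 (x y : P) : x = y by apply/matrixP => ? [].
exists P, (fun _ _ => 0); split; last by move=> x; apply: P0.
split; first by split=> *; apply: P0.
move=> W beta bb; exists \0; split=> [q t|h' _ x]; first by rewrite beta0.
by rewrite (P0 x 0) raddf0.
Qed.

(** Let E be the universal extension of Z, and E' the extension of the same T^n by
    Z' with classes phi(xi_l). By linearity of phi over B, every map T -> E followed by
    E -> T^n lifts to E'. In the pullback of E and E' over T^n, the trace W of T therefore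
    maps onto E, and all maps T -> E lift to W. The kernel of W -> E embeds in Z', so it
    has no maps from T, and its Ext^1(T, -) vanishes by the long exact sequence: it is
    zero. So W is the graph of a map theta : E -> E' over T^n, and theta restricts to a
    map f : Z -> Z' that sends each xi_l to phi(xi_l). *)
Lemma Ext1_full Z Z' (phi : {linear Ext1 T Z -> Ext1 T Z'}) :
  fin_gen Z -> fin_gen Z' -> in_F T Z' ->
  exists f : {linear Z -> Z'}, forall q, phi q = Ext1_map T f q.
Proof.
move=> Zfg Z'fg homZ'.
have [n [d [E [i [p [s [dc dspan HE extE Efg]]]]]]] := universal_extension Tfg Zfg TT.
have [[ii ps ex] sl sP sD] := HE.
have dP' l : exists d', exists dc' : is_cocycle d', phi (ext_class (dc l)) = ext_class dc'.
  exact: ext_class_surj.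
have [d' dE'] := exists_choice dP'.
have dc' l : is_cocycle (d' l) by case: (dE' l).
have phid l : phi (ext_class (dc l)) = ext_class (dc' l).
  by have [dc'' ->] := dE' l; apply: ext_class_irr.
have phi_comb (b : {linear T -> {ffun 'I_n -> T}}) :
    phi (ext_class (cocycle_pre b (ffun_cocycleP dc))) =
    ext_class (cocycle_pre b (ffun_cocycleP dc')).
  rewrite !ext_class_comb linear_sum; apply: eq_bigr => l _.
  by rewrite linearZ phid.
have [E' [i' [p' [s' HE']]]] := exists_extension (ffun_cocycleP dc').
have [[ii' ps' ex'] sl' sP' sD'] := HE'.
have E'fg : fin_gen E' by apply: extension_fin_gen HE' Z'fg _; apply: fin_gen_ffun.
(* The class of p g is a B-linear relation between the classes of the d_l; applying phi
   turns it into the same relation between those of the d'_l. *)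
have liftE' (g : {linear T -> E}) :
    exists g' : {linear T -> E'}, forall t, p' (g' t) = p (g t).
  have [h [hl hE]] := connecting_zero HE g.
  have pg0 : ext_class (cocycle_pre (p \o g : {linear T -> _}) (ffun_cocycleP dc)) = 0.
    by apply/ext_class_eq0; exists h.
  have := phi_comb (p \o g); rewrite pg0 linear0 => /esym/ext_class_eq0[h' [hl' hE'']].
  exact: (lift_of_coboundary HE' (b := p \o g) hl' hE'').
have dlin : linear (fun x : E * E' => p x.1 - p' x.2).
  by move=> a x y /=; rewrite !linearD !linearZ /= scalerDr addrACA.
have [P [j [ji jP]]] := exists_kernel (mk_linear dlin).
have Pfg : fin_gen P by apply: fin_gen_sub ji _; apply: fin_gen_prod.
have [W [L [jW [q [r [w [ses _ extW liftW _]]]]]]] := torsion_quotient Tfg Tre TT Pfg.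
have [jWi _ _] := ses.
pose pi1 : {linear W -> E} := fst \o (j \o jW).
pose pi2 : {linear W -> E'} := snd \o (j \o jW).
have pi12 x : p (pi1 x) = p' (pi2 x).
  have : p (j (jW x)).1 - p' (j (jW x)).2 = 0 by apply/jP; exists (jW x).
  by move/eqP; rewrite subr_eq0 => /eqP.
have lift1 (g : {linear T -> E}) : exists v : {linear T -> W}, forall t, pi1 (v t) = g t.
  have [g' gg'] := liftE' g.
  have glin : linear (fun t => (g t, g' t)) by move=> a x y; rewrite !linearP.
  have [|g1 g1E] := lift_through_inj ji (f := mk_linear glin).
    by move=> t; apply/jP; rewrite /= gg' subrr.
  have [v vE] := liftW g1.
  by exists v => t; rewrite /pi1 /= vE g1E.
have [m [wE wEs]] := tilting_generated Efg extE.
have pi1s : surjective pi1.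
  move=> e; have [t <-] := wEs e.
  have vP l := lift1 (wE \o ffun_in T l).
  have [v vE] := exists_choice vP.
  exists (\sum_l v l (t l)); rewrite linear_sum [in RHS](ffun_in_sum t) linear_sum.
  by apply: eq_bigr => l _; rewrite vE.
have Wfg : fin_gen W := fin_gen_sub jWi Pfg.
have [K [kap [ki kP]]] := exists_kernel pi1.
have sesK : short_exact kap pi1 by [].
have extK := ext_vanishes_sub sesK lift1 extW.
have Kfg := fin_gen_sub ki Wfg.
(* The second component of a map into K has image in the kernel Z' of p'. *)
have homK : in_F T K.
  move=> h t.
  have pi1k x : pi1 (kap x) = 0 by apply/kP; exists x.
  have [|h' h'E] := lift_through_inj ii' (f := pi2 \o (kap \o h)).
    by move=> x; apply/ex'; rewrite /comp -pi12 pi1k linear0.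
  have pi2k : pi2 (kap (h t)) = 0 by rewrite -[LHS]h'E homZ' linear0.
  apply: ki; apply: jWi; apply: ji; rewrite !linear0 [LHS]surjective_pairing.
  by congr pair; [apply: pi1k | apply: pi2k].
have K0 := tilting_orthogonal T_tilting Kfg homK extK.
have pi1i : injective pi1.
  by apply: linear_inj0 => x /kP[y <-]; rewrite (K0 y) linear0.
have [rho rhoK rhoK'] := linear_bij_inv (inj_surj_bij pi1i pi1s).
pose theta : {linear E -> E'} := pi2 \o rho.
have ptheta e : p' (theta e) = p e by rewrite /theta /= -pi12 rhoK'.
have [|f fE] := lift_through_inj ii' (f := theta \o i).
  by move=> z; apply/ex'; rewrite /comp ptheta; apply/ex; exists z.
exists f.
have hP u : exists z, i' z = theta (s u) - s' u.
  by apply/ex'; rewrite linearB ptheta sP sP' subrr.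
have [h hE] := exists_choice hP.
have thsl := klinear_comp (linear_klinear theta) sl.
have hl : klinear h.
  apply: klinear_reflect ii' _.
  rewrite (_ : (fun _ => _) = fun u => (theta \o s) u - s' u); last exact/funext.
  exact: klinear_sub.
(* theta s and s' are two sections over T^n; they differ by h. *)
have fd a u : f (ffun_cocycle d a u) - ffun_cocycle d' a u = bar_d0 h a u.
  have fD : i' (f (ffun_cocycle d a u)) = bar_d0 (theta \o s) a u.
    by rewrite fE -[LHS]/(theta (i _)) -sD bar_d0_post.
  apply: ii'; rewrite linearB fD -sD' bar_d0_post -bar_d0B.
  by congr (bar_d0 _ a u); apply/esym/funext.
have fl l : phi (ext_class (dc l)) = Ext1_map T f (ext_class (dc l)).
  rewrite phid Ext1_map_class; apply/esym/ext_class_eq.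
  exists (fun t => h (ffun_in T l t)); split.
    exact: klinear_comp hl (linear_klinear (ffun_in T l)).
  move=> a t; have := fd a (ffun_in T l t); rewrite !ffun_cocycle_in // => ->.
  by rewrite /bar_d0 linearZ.
pose F : {linear Ext1 T Z -> Ext1 T Z'} := Ext1_map T f.
have FE l : phi (ext_class (dc l)) = F (ext_class (dc l)) := fl l.
move=> x; rewrite -[RHS]/(F x); have [b ->] := cocycle_span_class dc dspan x.
by rewrite (linear_sum phi) (linear_sum F); apply: eq_bigr => l _; rewrite !linearZ FE.
Qed.

End BrennerButler.

(** * Powers of the radical *)

Section Radical.
Variable R : pzRingType.
Implicit Types X Y Z L : lmodType R.

Lemma radical_pre X Y Z (f : {linear Y -> Z}) (a : {linear X -> Y}) :
  radical f -> radical (f \o a).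
Proof. by move=> fr M h h' Mind; apply: (fr M (a \o h) h' Mind). Qed.

Lemma radical_post X Y Z (f : {linear X -> Y}) (b : {linear Y -> Z}) :
  radical f -> radical (b \o f).
Proof. by move=> fr M h h' Mind; apply: (fr M h (h' \o b) Mind). Qed.

Lemma rad_pow_pre n X Y Z (f : {linear Y -> Z}) (a : {linear X -> Y}) :
  rad_pow n f -> (0 < n)%N -> rad_pow n (f \o a : {linear X -> Z}).
Proof.
case: n => [|[|n]] // => [fr _|]; first exact: radical_pre.
move=> [m [W [g [h [gh fE]]]]] _; exists m, W, (fun i => g i \o a), h.
split=> [i|x]; last exact: fE.
by have [Wfg gr hr] := gh i; split=> //; apply: radical_pre.
Qed.

Lemma rad_pow_comp n X Y Z (f : {linear X -> Y}) (g : {linear Y -> Z}) :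
  fin_gen Y -> radical f -> rad_pow n.+1 g -> rad_pow n.+2 (g \o f : {linear X -> Z}).
Proof.
move=> Yfg fr gr; exists 1%N, (fun=> Y), (fun=> f), (fun=> g).
by split=> // x; rewrite big_ord1.
Qed.

Lemma rad_pow0 n X Y (f : {linear X -> Y}) : (forall x, f x = 0) -> rad_pow n.+2 f.
Proof.
move=> f0; exists 0%N, (fun=> X), (fun=> idfun), (fun=> f).
by split=> [[]//|x]; rewrite f0 big_ord0.
Qed.

Lemma rad_powD n X Y (f g h : {linear X -> Y}) :
  rad_pow n.+2 f -> rad_pow n.+2 g -> (forall x, h x = f x + g x) -> rad_pow n.+2 h.
Proof.
move=> [m [W [a [b [ab fE]]]]] [m' [W' [a' [b' [ab' gE]]]]] hE.
pose WW (s : 'I_m + 'I_m') := match s with inl i => W i | inr j => W' j end.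
pose aa s : {linear X -> WW s} :=
  match s return {linear X -> WW s} with inl i => a i | inr j => a' j end.
pose bb s : {linear WW s -> Y} :=
  match s return {linear WW s -> Y} with inl i => b i | inr j => b' j end.
exists (m + m')%N, (fun i => WW (fintype.split i)),
  (fun i => aa (fintype.split i)), (fun i => bb (fintype.split i)).
split=> [i|x]; first by case: (fintype.split i) => j; [exact: (ab j) | exact: (ab' j)].
rewrite hE fE gE big_split_ord; congr (_ + _); apply: eq_bigr => i _.
  by rewrite (unsplitK (inl i) : fintype.split (lshift m' i) = inl i).
by rewrite (unsplitK (inr i) : fintype.split (rshift m i) = inr i).
Qed.

Lemma rad_pow_sum n X Y (I : Type) (r : seq I)
    (f : I -> {linear X -> Y}) (g : {linear X -> Y}) :
  (forall i, rad_pow n.+2 (f i)) -> (forall x, g x = \sum_(i <- r) f i x) ->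
  rad_pow n.+2 g.
Proof.
move=> fr; elim: r g => [|i r IHr] g gE.
  by apply: rad_pow0 => x; rewrite gE big_nil.
apply: (@rad_powD n _ _ (f i) (mk_linear (sum_linear r f))) => //;
  first exact: IHr.
by move=> x; rewrite gE big_cons.
Qed.

(** If b f a is an isomorphism, composing b with its inverse makes it the identity. *)
Lemma not_radical X Y (f : {linear X -> Y}) : ~ radical f ->
  exists L (a : {linear L -> X}) (b : {linear Y -> L}),
    indecomposable L /\ forall x, b (f (a x)) = x.
Proof.
move=> nr; apply: contrapT => nex; apply: nr => L h h' Lind hb.
have [u uK uK'] := linear_bij_inv (f := h' \o f \o h : {linear L -> L}) hb.
by apply: nex; exists L, h, (u \o h'); split=> // x; apply: uK.
Qed.

(** In a factorization f = g h, if neither h is a split monomorphism nor g a split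
    epimorphism, then both are radical, since a module L split off through h is a nonzero
    retract of the indecomposable X, hence all of X, and similarly for g and Y. So f would
    lie in the square of the radical. *)
Lemma irreducible_of_rad X Y (f : {linear X -> Y}) :
  indecomposable X -> indecomposable Y -> radical f -> ~ rad_pow 2 f ->
  irreducible_morphism f.
Proof.
move=> Xind Yind fr fnr2; split.
- by move=> [g gf]; apply: (fr X idfun g Xind); exists id => x; apply: gf.
- by move=> [g fg]; apply: (fr Y g idfun Yind); exists id => x; apply: fg.
move=> Z h g Zfg fE; apply: contrapT => /not_orP[hs gs]; apply: fnr2.
rewrite (linear_ext fE : f = (g \o h : {linear X -> Y})).
apply: (rad_pow_comp (n := 0)) Zfg _ _.
  apply: contrapT => /not_radical[L [a [b [[_ L0 _] abE]]]]; apply: hs.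
  have aK := @retract_of_indecomposable _ L X a (b \o h) Xind L0 abE.
  by exists (a \o b) => x; apply: aK.
apply: contrapT => /not_radical[L [a [b [[_ L0 _] abE]]]]; apply: gs.
have bK := @retract_of_indecomposable _ L Y (g \o a) b Yind L0 abE.
by exists (a \o b) => x; apply: bK.
Qed.

End Radical.

(** * Functoriality of Ext^1 *)

Section Functor.
Variables (k : fieldType) (A : falgType k) (T : lmodType A).
Implicit Types (X Y Z U L E : lmodType A).

(** Ext1_map bundled as a linear map, for use as an argument of compositions. *)
Definition Ext1_lin X Y (f : {linear X -> Y}) : {linear Ext1 T X -> Ext1 T Y} := Ext1_map T f.

Lemma Ext1_lin_class X Y (f : {linear X -> Y}) (d : A -> T -> X) (dc : is_cocycle d) :
  Ext1_lin f (ext_class dc) = ext_class (cocycle_post f dc).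
Proof. exact: Ext1_map_class. Qed.

Lemma Ext1_lin_comp X Y Z (f : {linear X -> Y}) (g : {linear Y -> Z}) :
  Ext1_lin (g \o f) = (Ext1_lin g \o Ext1_lin f : {linear _ -> _}).
Proof.
apply: linear_ext => q; have [d [dc ->]] := ext_class_surj q.
by rewrite -[RHS]/(Ext1_lin g (Ext1_lin f _)) !Ext1_lin_class; apply: ext_class_irr.
Qed.

Lemma Ext1_lin_id X : Ext1_lin (idfun : {linear X -> X}) = (idfun : {linear _ -> _}).
Proof.
apply: linear_ext => q; have [d [dc ->]] := ext_class_surj q.
by rewrite !Ext1_lin_class; apply: ext_class_irr.
Qed.

Lemma Ext1_linD X Y (f g h : {linear X -> Y}) : (forall x, h x = f x + g x) ->
  forall q, Ext1_lin h q = Ext1_lin f q + Ext1_lin g q.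
Proof.
move=> hE q; have [d [dc ->]] := ext_class_surj q.
by rewrite !Ext1_lin_class ext_classD; apply: ext_class_irr => a t.
Qed.

Lemma Ext1_lin0 X Y (f : {linear X -> Y}) : (forall x, f x = 0) ->
  forall q, Ext1_lin f q = 0.
Proof.
move=> f0 q; have [d [dc ->]] := ext_class_surj q.
by rewrite !Ext1_lin_class -ext_class0; apply: ext_class_irr => a t.
Qed.

Lemma Ext1_lin_sum X Y (I : Type) (r : seq I)
    (f : I -> {linear X -> Y}) (g : {linear X -> Y}) :
  (forall x, g x = \sum_(i <- r) f i x) ->
  forall q, Ext1_lin g q = \sum_(i <- r) Ext1_lin (f i) q.
Proof.
elim: r g => [|i r IHr] g gE q.
  by rewrite big_nil Ext1_lin0 // => x; rewrite gE big_nil.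
rewrite big_cons -(IHr (mk_linear (sum_linear r f))) //; apply: Ext1_linD.
by move=> x; rewrite gE big_cons.
Qed.

End Functor.

(** * Paths of radical maps and their images *)

Section Paths.
Variables (k : fieldType) (A : falgType k) (T : lmodType A).
Implicit Types (X Y Z U L E M N : lmodType A).
Hypotheses (T_tilting : tilting T) (T_sep : separating T).
Let B := End_op T.
Local Notation F' := (@Ext1_lin k A T _ _).

Lemma idempotent_Ext1 X (s : {linear X -> X}) : fin_gen X -> in_F T X ->
  (forall q, Ext1_lin T s (Ext1_lin T s q) = Ext1_lin T s q) ->
  forall x, s (s x) = s x.
Proof.
move=> Xfg homX ss x; apply/eqP; rewrite -subr_eq0; apply/eqP.
pose d : {linear X -> X} := (s \o s) \- s.
apply: (Ext1_faithful T_tilting (f := d)) => // q.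
rewrite -[LHS]/(Ext1_lin T d q); apply: (addIr (Ext1_lin T s q)); rewrite add0r.
rewrite -(@Ext1_linD _ _ T _ _ d s (s \o s)) => [|y]; last by rewrite /= subrK.
by rewrite Ext1_lin_comp -[LHS]/(Ext1_lin T s (Ext1_lin T s q)) ss.
Qed.

(** If b F'(g) a = 1 on a nonzero L, then a b F'(g) is a nonzero idempotent of F'(M).
    By fullness it is F'(r g) for some r : N -> M, and by faithfulness r g is idempotent,
    hence the identity of M, which contradicts g being radical. *)
Lemma radical_Ext1 M N (g : {linear M -> N}) : indecomposable M -> in_F T M ->
  indecomposable N -> in_F T N -> radical g -> radical (Ext1_lin T g).
Proof.
move=> Mind homM Nind homN gr.
have [Mfg _ _] := Mind; have [Nfg _ _] := Nind.
apply: contrapT => /not_radical[L [a [b [[_ L0 _] abE]]]].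
have [r rE] := Ext1_full T_tilting (a \o b : {linear _ -> _}) Nfg Mfg homM.
have sE q : Ext1_lin T (r \o g) q = a (b (Ext1_lin T g q)).
  by rewrite Ext1_lin_comp -[LHS]/(Ext1_map T r _) -rE.
have [|s0|s1] := @indecomposable_idem _ M (r \o g) Mind.
- by apply: (idempotent_Ext1 Mfg homM) => q; rewrite !sE abE.
- apply: L0 => x; rewrite -(abE x).
  have -> : a x = 0 by rewrite -[in LHS](abE x) -sE; apply: Ext1_lin0.
  by rewrite !linear0.
- by apply: (gr M idfun r Mind); exists id => x; apply: s1.
Qed.

(** Paths of radical maps between indecomposable modules in F(T). They are the
    preimages under F' of the paths of irreducible maps sought. *)
Inductive rad_path : nat -> forall X Y, {linear X -> Y} -> Prop :=
| rad_path_nil X : indecomposable X -> in_F T X ->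
    rad_path 0 (idfun : {linear X -> X})
| rad_path_cons n X Y Z (f : {linear X -> Y}) (g : {linear Y -> Z}) :
    indecomposable X -> in_F T X -> radical f -> rad_path n g ->
    rad_path n.+1 (g \o f : {linear X -> Z}).

Lemma rad_path_source n X Y (f : {linear X -> Y}) : rad_path n f ->
  indecomposable X /\ in_F T X.
Proof. by case. Qed.

(** Finite sums of images of paths. The index type is an arbitrary finite type, so
    that sums of such maps are indexed by disjoint unions. *)
Definition path_sum n M N (phi : Ext1 T M -> Ext1 T N) :=
  exists (I : finType) (p : I -> {linear M -> N}),
    (forall i, rad_path n (p i)) /\ forall q, phi q = \sum_i Ext1_lin T (p i) q.

Lemma path_sum0 n M N (phi : Ext1 T M -> Ext1 T N) :
  (forall q, phi q = 0) -> path_sum n phi.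
Proof.
move=> phi0; exists void, (fun=> \0); split=> [[]|q].
by rewrite phi0 big_pred0 // => -[].
Qed.

Lemma path_sumD n M N (phi psi : Ext1 T M -> Ext1 T N) :
  path_sum n phi -> path_sum n psi -> path_sum n (fun q => phi q + psi q).
Proof.
move=> [I [p [pP pE]]] [J [r [rP rE]]].
exists (I + J)%type, (fun s => match s with inl i => p i | inr j => r j end).
by split=> [[]|q] //; rewrite big_sumType pE rE.
Qed.

Lemma path_sum_big n M N (I : Type) (r : seq I) (phi : I -> Ext1 T M -> Ext1 T N) :
  (forall i, path_sum n (phi i)) -> path_sum n (fun q => \sum_(i <- r) phi i q).
Proof.
move=> phiP; elim: r => [|i r IHr]; first by apply: path_sum0 => q; rewrite big_nil.
have [J [p [pP pE]]] := path_sumD (phiP i) IHr.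
by exists J, p; split=> // q; rewrite big_cons.
Qed.

Lemma path_sum_ext n M N (phi psi : Ext1 T M -> Ext1 T N) :
  (forall q, phi q = psi q) -> path_sum n phi -> path_sum n psi.
Proof. by move=> e [J [p [pP pE]]]; exists J, p; split=> // q; rewrite -e. Qed.

(** Decompose the modules through which g factors. The indecomposable summands lie
    in T(T) or in F(T) as T is separating; those in T(T) contribute zero since F' kills
    them, and those in F(T) lead by induction to paths inside F(T). *)
Lemma rad_pow_path_sum n M N (g : {linear M -> N}) :
  indecomposable M -> in_F T M -> indecomposable N -> in_F T N ->
  rad_pow n.+1 g -> path_sum n.+1 (Ext1_lin T g).
Proof.
move=> Mind homM Nind homN.
elim: n M g Mind homM => [|n IHn] M g Mind homM.
  move=> gr; exists unit, (fun=> idfun \o g); split=> [_|q].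
    by apply: rad_path_cons => //; apply: rad_path_nil.
  rewrite (big_pred1 tt) => [|[]//]; congr (_ q); congr (Ext1_lin T _); exact: linear_ext.
move=> [m [Z [a [b [abP gE]]]]].
have gE' q : Ext1_lin T g q = \sum_(i < m) Ext1_lin T (b i \o a i) q.
  exact: Ext1_lin_sum.
apply: (path_sum_ext (fun q => esym (gE' q))); apply: path_sum_big => i.
have [Zfg ar br] := abP i.
have [J [W [io [pr [Wind prio ioprE]]]]] := exists_decomposition Zfg.
have bE q : Ext1_lin T (b i \o a i) q =
    \sum_j Ext1_lin T ((b i \o io j) \o (pr j \o a i)) q.
  by apply: Ext1_lin_sum => x; rewrite -linear_sum -ioprE.
apply: (path_sum_ext (fun q => esym (bE q))); apply: path_sum_big => j.
have [WT|WF] := T_sep (Wind j).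
  apply: path_sum0 => q.
  by rewrite Ext1_lin_comp -[LHS]/(Ext1_lin T _ (Ext1_lin T _ q)) [Ext1_lin T _ q]WT linear0.
have [|I [p [pP pE]]] := IHn _ (b i \o io j : {linear W j -> N}) (Wind j) WF.
  exact: rad_pow_pre.
exists I, (fun i' => p i' \o (pr j \o a i)); split=> [i'|q].
  by apply: rad_path_cons => //; apply: radical_post.
rewrite Ext1_lin_comp -[LHS]/(Ext1_lin T _ (Ext1_lin T _ q)) pE.
by apply: eq_bigr => i' _; rewrite [in RHS]Ext1_lin_comp.
Qed.

(** The radical map in front makes the statement cover paths of length 0, for which
    the image of the path alone is an identity. *)
Lemma rad_path_comp n X Y (p : {linear X -> Y}) : rad_path n p ->
  forall (V : lmodType B) (a : {linear V -> Ext1 T X}), radical a ->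
  rad_pow n.+1 (Ext1_lin T p \o a : {linear V -> Ext1 T Y}).
Proof.
elim=> {n X Y p} [X Xind homX V a ar|n X Y Z f g Xind homX fr gP IHg V a ar].
  by rewrite Ext1_lin_id; apply: radical_post.
have [Yind homY] := rad_path_source gP.
have -> : (Ext1_lin T (g \o f) \o a : {linear V -> _}) =
    ((Ext1_lin T g \o Ext1_lin T f) \o a : {linear V -> _}).
  by apply: linear_ext => x; rewrite Ext1_lin_comp.
apply: (rad_pow_comp (Y := Ext1 T X) _ ar).
  by apply: fin_gen_Ext1 => //; case: Xind.
exact: IHg (radical_Ext1 Xind homX Yind homY fr).
Qed.

Lemma rad_pow_rad_path n X Y (p : {linear X -> Y}) :
  rad_path n p -> rad_pow n (Ext1_lin T p).
Proof.
case=> {n X Y p} // n X W Y f g Xind homX fr gP; rewrite Ext1_lin_comp.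
have [Wind homW] := rad_path_source gP.
apply: (rad_path_comp gP); exact: radical_Ext1.
Qed.

(** A decomposition of F'(X) gives an idempotent, which by full faithfulness comes
    from an idempotent of X. *)
Lemma indecomposable_Ext1 X : indecomposable X -> in_F T X -> indecomposable (Ext1 T X).
Proof.
move=> Xind homX; have [Xfg X0 _] := Xind; split; first exact: fin_gen_Ext1.
  move=> E0; apply: X0.
  by apply: (Ext1_faithful T_tilting (f := (idfun : {linear X -> X}))) => // q; apply: E0.
move=> Y Z [f /linear_bij_inv[g fK gK]].
have elin : linear (fun q => g ((f q).1, 0)).
  move=> a x y; rewrite -linearP; congr (g _); rewrite linearP; congr pair.
  by rewrite /= scaler0 addr0.
have [s sE] := Ext1_full T_tilting (mk_linear elin) Xfg Xfg homX.
have sE' q : Ext1_lin T s q = g ((f q).1, 0) by rewrite -[LHS]/(Ext1_map T s q) -sE.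
have [|s0|s1] := @indecomposable_idem _ X s Xind.
- by apply: (idempotent_Ext1 Xfg homX) => q; rewrite !sE' gK.
- left=> y; have := sE' (g (y, 0)); rewrite Ext1_lin0 // gK /=.
  by move=> /(congr1 f); rewrite linear0 gK => /(congr1 fst).
- right=> z; have := sE' (g (0, z)).
  have -> : Ext1_lin T s = Ext1_lin T idfun by congr (Ext1_lin T _); apply: linear_ext.
  by rewrite Ext1_lin_id gK => /(congr1 f); rewrite !gK => /(congr1 snd).
Qed.

(** If one step lay in the square of the radical, the whole path would lie one power
    deeper. So each step is in the radical but not in its square, and it is irreducible. *)
Lemma irr_path_rad_path n X Y (p : {linear X -> Y}) : rad_path n p ->
  ~ rad_pow n.+1 (Ext1_lin T p) -> irr_path (@in_X A T) n (Ext1_lin T p).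
Proof.
elim=> {n X Y p} [X Xind homX _|n X Y Z f g Xind homX fr gP IHg].
  rewrite Ext1_lin_id; apply: irr_path_nil; first exact: indecomposable_Ext1.
  by apply: Ext1_in_X => //; case: Xind.
rewrite Ext1_lin_comp => nr.
have [Yind homY] := rad_path_source gP.
have Ffr := radical_Ext1 Xind homX Yind homY fr.
have [[Xfg _ _] [Yfg _ _]] := (Xind, Yind).
have EYfg := fin_gen_Ext1 T_tilting Yfg.
apply: irr_path_cons.
- exact: indecomposable_Ext1.
- exact: Ext1_in_X.
- apply: irreducible_of_rad => //; try exact: indecomposable_Ext1.
  move=> [m [V [a [b [abP fE]]]]]; apply: nr.
  exists m, V, a, (fun i => Ext1_lin T g \o b i); split=> [i|x].
    have [Vfg ar br] := abP i; split=> //; exact: rad_path_comp.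
  by rewrite -[LHS]/(Ext1_lin T g (Ext1_lin T f x)) fE linear_sum.
- by apply: IHg => gr; apply: nr; apply: rad_pow_comp.
Qed.

End Paths.

(** * The radical filtration under Ext^1(T, -) *)

Theorem proposition2p2 (k : closedFieldType) (A : falgType k)
    (T : lmodType A) (M N : lmodType A) (g : {linear M -> N}) (n : nat)
    (A_basic : basic A)
    (T_tilting : tilting T) (T_separating : separating T)
    (M_indec : indecomposable M) (N_indec : indecomposable N)
    (M_in_F : in_F T M) (N_in_F : in_F T N)
    (n_ge1 : (1 <= n)%N) (g_rad : rad_pow n g) :
  rad_pow n (Ext1_map T g : {linear Ext1 T M -> Ext1 T N}) /\
  (has_depth n (Ext1_map T g : {linear Ext1 T M -> Ext1 T N}) ->
   exists p : {linear Ext1 T M -> Ext1 T N},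
     irr_path (@in_X A T) n p /\ exists x, p x <> 0).
Proof.
case: n n_ge1 g_rad => // n _ g_rad.
have [I [p [pP pE]]] :=
  rad_pow_path_sum T_separating M_indec M_in_F N_indec N_in_F g_rad.
split.
  case: n g_rad p pP pE => [|n] g_rad p pP pE; first exact: radical_Ext1.
  apply: (rad_pow_sum (f := fun i => Ext1_lin T (p i))) pE => i.
  exact: rad_pow_rad_path.
move=> [_ g_nrad]; have [i nri] : exists i, ~ rad_pow n.+2 (Ext1_lin T (p i)).
  apply: contrapT => nex; apply: g_nrad.
  apply: (rad_pow_sum (f := fun i => Ext1_lin T (p i))) pE => i.
  by apply: contrapT => nri; apply: nex; exists i.
exists (Ext1_lin T (p i)); split; first exact: irr_path_rad_path.
apply: contrapT => n0; apply: nri; apply: rad_pow0 => x.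
by apply: contrapT => px; apply: n0; exists x.
Qed.
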